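(* Assume the boundary conditions $\boldsymbol m\cdot\boldsymbol n=0$ and $\boldsymbol H\times\boldsymbol n=\boldsymbol0$ are satisfied on $\partial\Omega$. Let $\{\rho_h^{n+1},\boldsymbol m_h^{n+1},E_h^{n+1},\boldsymbol H_h^{n+1}\}$ be the output of the method hall_mhd_update, described in the context, applied to $\{\rho_h^{n},\boldsymbol m_h^{n},E_h^{n},\boldsymbol H_h^{n}\}$, and write $\boldsymbol u_i=[\rho_i,\boldsymbol m_i,E_i]^{\top}$ for nodal states. Then: (a) Energy stability. If euler_system_update satisfies the conservation property (C), then $$\sum_{i\in\mathcal V}m_iE_i^{n+1}+\tfrac\mu2\|\boldsymbol H_h^{n+1}\|_{L^2(\Omega)}^2=\sum_{i\in\mathcal V}m_iE_i^{n}+\tfrac\mu2\|\boldsymbol H_h^{n}\|_{L^2(\Omega)}^2 .$$ (b) Admissibility. If euler_system_update satisfies the admissibility property (A) and $\boldsymbol u_i^n\in\mathcal A$ for all $i\in\mathcal V$, then $\boldsymbol u_i^{n+1}\in\mathcal A$ for all $i\in\mathcal V$. (c) Entropy dissipation. If euler_system_update satisfies the entropy-dissipation inequality (D), then $$\sum_{i\in\mathcal V}m_i\,\eta(\boldsymbol u_i^{n+1})\le\sum_{i\in\mathcal V}m_i\,\eta(\boldsymbol u_i^{n}).$$ (d) Involution constraints. $$(\boldsymbol H_h^{n+1},\nabla\omega_h)_{L^2(\Omega)}=(\boldsymbol H_h^{n},\nabla\omega_h)_{L^2(\Omega)}\qquad\text{for all }\omega_h\in\mathbb P_{h,0}.$$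 The properties (C), (A), (D) and the set $\mathcal A$ are those defined in the context.
   Context: Finite element spaces. $\Omega\subset\mathbb R^d$ ($d=2$ or $3$) is a bounded domain with outward unit normal $\boldsymbol n$ and a conforming simplicial mesh $\mathcal T_h$; $T_K:\widehat K\to K$ is a diffeomorphism from the unit simplex $\widehat K$ to $K\in\mathcal T_h$, and $\mathbb P^k(\widehat K)$ denotes polynomials of degree at most $k$. Define - $\mathbb V_h=\{v_h\in C^0(\Omega): v_h\circ T_K\in\mathbb P^1(\widehat K)\ \forall K\}$, with nodal basis $\{\phi_i\}_{i\in\mathcal V}$ ($\phi_i(\boldsymbol x_j)=\delta_{ij}$, $\sum_i\phi_i=1$), and lumped masses $m_i=\int_\Omega\phi_i\,d\boldsymbol x$; - $\mathbb H_h=\{\boldsymbol\xi_h\in H(\mathrm{curl},\Omega):[\nabla T_K]^{\top}(\boldsymbol\xi_h\circ T_K)\in[\mathbb P^1(\widehat K)]^d\ \forall K\}$ and $\mathbb H_{h,0}=\{\boldsymbol\xi_h\in\mathbb H_h:\boldsymbol\xi_h\times\boldsymbol n=\boldsymbol0\text{ on }\partial\Omega\}$; - $\mathbb P_h=\{\omega_h\in C^0(\Omega):\omega_h\circ T_K\in\mathbb P^2(\widehat K)\ \forall K\}$ and $\mathbb P_{h,0}=\{\omega_h\in\mathbb P_h:\omega_h=0\text{ on }\partial\Omega\}$. Convention for $d=2$: all vector fields have three components and are independent of the out-of-plane coordinate $z$ ($\partial_z\equiv 0$). The space $\mathbb H_h$ is replaced by fields whose in-plane part is in the two-dimensional space $\mathbb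 H_h$ above and whose $z$-component is in $\mathbb V_h$; $\mathbb H_{h,0}$ is its subspace with $\boldsymbol\xi_h\times\boldsymbol n=\boldsymbol0$ on $\partial\Omega$ where $\boldsymbol n=(n_x,n_y,0)$; $\mathrm{curl}\boldsymbol H=(\partial_yH_z,-\partial_xH_z,\partial_xH_y-\partial_yH_x)$; and $\nabla\omega=(\partial_x\omega,\partial_y\omega,0)$. Lumped product: $\langle\rho_h\boldsymbol v_h,\boldsymbol w_h\rangle=\sum_{i\in\mathcal V}m_i\rho_i\,\boldsymbol v_i\cdot\boldsymbol w_i$. Discrete hydrodynamic fields are $\rho_h=\sum_i\rho_i\phi_i$, $\boldsymbol m_h=\sum_i\boldsymbol m_i\phi_i$, $E_h=\sum_iE_i\phi_i$ with $\rho_i,E_i\in\mathbb R$, $\boldsymbol m_i\in\mathbb R^3$; the magnetic field is $\boldsymbol H_h\in\mathbb H_{h,0}$. The constants $\mu>0$, $d_i>0$, $r>0$ are given, and $r_h^n\in\mathbb V_h$ is a given (explicit) function with $r_h^n\ge r$. Procedure source_update$(\{\rho_h^1,\boldsymbol m_h^1,E_h^1,\boldsymbol H_h^1,\tau\})$, returning $\{\rho_h^2,\boldsymbol m_h^2,E_h^2,\boldsymbol H_h^2\}$. Set $\boldsymbol v_h^1=\sum_i(\boldsymbol m_i^1/\rho_i^1)\phi_i$. Find $\{\boldsymbol v_h^2,\boldsymbol H_h^2\}\in\mathbb V_h^3\times\mathbb H_{h,0}$ such that, with $\bar{\boldsymbol v}=\frac12(\boldsymbol v_h^1+\boldsymbol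 v_h^2)$, $\bar{\boldsymbol H}=\frac12(\boldsymbol H_h^1+\boldsymbol H_h^2)$, for all $\{\boldsymbol w_h,\boldsymbol\xi_h\}\in\mathbb V_h^3\times\mathbb H_{h,0}$, $$\begin{aligned} &\langle\rho_h^1(\boldsymbol v_h^2-\boldsymbol v_h^1),\boldsymbol w_h\rangle-\tau\mu(\mathrm{curl}\bar{\boldsymbol H}\times\bar{\boldsymbol H},\boldsymbol w_h)_{L^2(\Omega)}=0,\\ &\mu(\boldsymbol H_h^2-\boldsymbol H_h^1,\boldsymbol\xi_h)_{L^2(\Omega)}+\tau\mu(\mathrm{curl}\boldsymbol\xi_h\times\bar{\boldsymbol H},\bar{\boldsymbol v})_{L^2(\Omega)}+\tau(r_h^n\,\mathrm{curl}\bar{\boldsymbol H},\mathrm{curl}\boldsymbol\xi_h)_{L^2(\Omega)}+\tau\mu d_i\big(\tfrac1{\rho_h^1}\mathrm{curl}\bar{\boldsymbol H}\times\bar{\boldsymbol H},\mathrm{curl}\boldsymbol\xi_h\big)_{L^2(\Omega)}=0 . \end{aligned}$$ Then for all $i\in\mathcal V$ set $\rho_i^2:=\rho_i^1$, $\boldsymbol m_i^2:=\rho_i^1\boldsymbol v_i^2$ and $$E_i^2:=E_i^1+\frac12\frac{|\boldsymbol m_i^2|^2}{\rho_i^1}-\frac12\frac{|\boldsymbol m_i^1|^2}{\rho_i^1}+\tau J_i,\qquad J_i:=\frac1{m_i}\int_\Omega r_h^n|\mathrm{curl}\bar{\boldsymbol H}|^2\phi_i\,d\boldsymbol x .$$ Procedure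 euler_system_update: an abstract numerical procedure for the compressible Euler equations mapping $\{\rho_h,\boldsymbol m_h,E_h\}$ to an updated triple; it either determines the time-step $\tau_n>0$ itself and returns it, or uses a supplied $\tau_n$. Procedure hall_mhd_update$(\{\rho_h^n,\boldsymbol m_h^n,E_h^n,\boldsymbol H_h^n\})$: 1. $\{\rho_h^1,\boldsymbol m_h^1,E_h^1,\tau_n\}:=$ euler_system_update$(\{\rho_h^n,\boldsymbol m_h^n,E_h^n\})$, $\boldsymbol H_h^1:=\boldsymbol H_h^n$; 2. $\{\rho_h^2,\boldsymbol m_h^2,E_h^2,\boldsymbol H_h^2\}:=$ source_update$(\{\rho_h^1,\boldsymbol m_h^1,E_h^1,\boldsymbol H_h^1,2\tau_n\})$; 3. $\{\rho_h^{n+1},\boldsymbol m_h^{n+1},E_h^{n+1}\}:=$ euler_system_update$(\{\rho_h^2,\boldsymbol m_h^2,E_h^2,\tau_n\})$, $\boldsymbol H_h^{n+1}:=\boldsymbol H_h^2$. All steps are assumed to be executable (the nodal densities entering source_update are positive, a solution of its nonlinear system is given, and for the entropy statement all nodal states are in the domain of $s$). Possible properties of euler_system_update (for any input nodal states $\boldsymbol u_i^{\rm in}$ and corresponding output $\boldsymbol u_i^{\rm out}$): (C) $\sum_im_i\rho_i^{\rm out}=\sum_im_i\rho_i^{\rm in}$, $\sum_im_i\boldsymbol m_i^{\rm out}=\sum_im_i\boldsymbol m_i^{\rm in}$, $\sum_im_iE_i^{\rm out}=\sum_im_iE_i^{\rm in}$; (A) if $\boldsymbol u_i^{\rm in}\in\mathcal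 A$ for all $i$ then $\boldsymbol u_i^{\rm out}\in\mathcal A$ for all $i$, where $\mathcal A=\{[\rho,\boldsymbol m,E]^{\top}:\rho>0,\ E-\frac1{2\rho}|\boldsymbol m|^2>0\}$; (D) $\sum_im_i\eta(\boldsymbol u_i^{\rm out})\le\sum_im_i\eta(\boldsymbol u_i^{\rm in})$. Equation of state. The specific entropy $s=s(\mathsf v,e)$ is a given twice continuously differentiable function of specific volume $\mathsf v=1/\rho$ and specific internal energy $e$, on a convex domain contained in $\mathbb R^+\times\mathbb R^+$. For $\boldsymbol u=[\rho,\boldsymbol m,E]^{\top}$: $e(\boldsymbol u)=\frac E\rho-\frac{|\boldsymbol m|^2}{2\rho^2}$ and $\eta(\boldsymbol u)=-\rho\,s(\frac1\rho,e(\boldsymbol u))$. Standing assumptions: $\partial s/\partial e>0$ on the domain of $s$, and $s$ is concave: $\frac{\partial^2s}{\partial \mathsf v^2}\le0$, $\frac{\partial^2s}{\partial e^2}\le0$, $\frac{\partial^2s}{\partial \mathsf v^2}\frac{\partial^2s}{\partial e^2}-\big(\frac{\partial^2s}{\partial \mathsf v\partial e}\big)^2\ge0$. *)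

(* Defs.v *)
From HB Require Import structures.
From mathcomp Require Import all_boot all_order all_algebra.
From mathcomp Require Import all_classical all_reals all_analysis.
Set Implicit Arguments.
Unset Strict Implicit.
Unset Printing Implicit Defensive.
Import Order.TTheory GRing.Theory Num.Theory.
Import numFieldNormedType.Exports.
Local Open Scope classical_set_scope.
Local Open Scope ring_scope.

Definition rV_display : measure_display. Proof. exact: default_measure_display. Qed.

Section measurable_rV.
Context (R : realType) (d : nat).

Let coord (i : 'I_d) (x : 'rV[R]_d) : measurableTypeR R := x 0 i.

Let rV_set0 : g_sigma_preimage coord set0.
Proof. exact: sigma_algebra0. Qed.

Let rV_setC A : g_sigma_preimage coord A -> g_sigma_preimage coord (~` A).
Proof. exact: sigma_algebraC. Qed.

Let rV_bigcup (F : (set _)^nat) : (forall i, g_sigma_preimage coord (F i)) ->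
  g_sigma_preimage coord (\bigcup_i (F i)).
Proof. exact: sigma_algebra_bigcup. Qed.

HB.instance Definition _ := @isMeasurable.Build rV_display 'rV[R]_d
  (g_sigma_preimage coord) rV_set0 rV_setC rV_bigcup.

Lemma measurable_coord (i : 'I_d) :
  measurable_fun [set: 'rV[R]_d] (fun x => x 0 i : measurableTypeR R).
Proof.
move=> _ Y mY; rewrite setTI; apply: sub_sigma_algebra => /=.
rewrite -bigcup_seq/=; exists i => /=; first by rewrite mem_index_enum.
by exists Y => //; rewrite setTI.
Qed.

Lemma measurable_fun_rV d1 (T1 : measurableType d1) (f : T1 -> 'rV[R]_d) :
  (forall i, measurable_fun [set: T1] (fun x => f x 0 i : measurableTypeR R)) ->
  measurable_fun [set: T1] f.
Proof.
move=> mf _ A mA; rewrite setTI; move: A mA.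
apply: smallest_sub.
  split => [|A|F].
  - by rewrite preimage_set0; exact: measurable0.
  - by move=> mA; rewrite setTD preimage_setC; exact: measurableC.
  - by move=> mF; rewrite preimage_bigcup; exact: bigcup_measurable.
rewrite -bigcup_seq; apply: bigcup_sub => i _ A [B mB <-].
by rewrite setTI; have := mf i measurableT B mB; rewrite setTI.
Qed.

End measurable_rV.

Definition rV_cons (R : realType) (d : nat) (p : measurableTypeR R * 'rV[R]_d) :
    'rV[R]_d.+1 :=
  \row_i (if unlift ord0 i is Some j then p.2 0 j else p.1).

Definition rV_split (R : realType) (d : nat) (x : 'rV[R]_d.+1) :
    measurableTypeR R * 'rV[R]_d := (x 0 ord0, \row_j x 0 (lift ord0 j)).

Lemma rV_consK (R : realType) (d : nat) : cancel (@rV_cons R d) (@rV_split R d).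
Proof.
move=> [t y]; rewrite /rV_split /rV_cons !mxE unlift_none; congr pair.
by apply/rowP => j; rewrite !mxE liftK.
Qed.

Lemma measurable_rV_cons (R : realType) (d : nat) :
  measurable_fun setT (@rV_cons R d).
Proof.
apply: measurable_fun_rV => i; rewrite /rV_cons.
case: (unliftP ord0 i) => [j ->|->].
- rewrite [X in measurable_fun _ X](_ : _ =
    (fun y : 'rV[R]_d => y 0 j : measurableTypeR R) \o snd); last first.
    by apply/funext => -[t y]; rewrite mxE liftK.
  by apply: measurableT_comp => //; exact: measurable_coord.
- rewrite [X in measurable_fun _ X](_ : _ = fst) //.
  by apply/funext => -[t y]; rewrite mxE unlift_none.
Qed.

Lemma measurable_rV_split (R : realType) (d : nat) :
  measurable_fun setT (@rV_split R d).
Proof.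
apply/measurable_fun_pairP; split => /=; first exact: measurable_coord.
apply: measurable_fun_rV => i /=.
rewrite [X in measurable_fun _ X](_ : _ =
  fun x : 'rV[R]_d.+1 => x 0 (lift ord0 i) : measurableTypeR R).
  exact: measurable_coord.
by apply/funext => x; rewrite /= mxE.
Qed.

Section lebesgue_step.
Context (R : realType) (d : nat).
Variable nu : {sigma_finite_measure set 'rV[R]_d -> \bar R}.

Definition lebesgue_step : set 'rV[R]_d.+1 -> \bar R :=
  pushforward (@lebesgue_measure R \x nu)%E (@rV_cons R d).

Let step0 : lebesgue_step set0 = 0%E.
Proof. by rewrite /lebesgue_step /pushforward preimage_set0 measure0. Qed.

Let step_ge0 A : (0 <= lebesgue_step A)%E.
Proof. by rewrite /lebesgue_step /pushforward measure_ge0. Qed.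

Let step_sigma_additive : semi_sigma_additive lebesgue_step.
Proof.
move=> F mF tF mUF; rewrite /lebesgue_step /pushforward preimage_bigcup.
apply: measure_semi_sigma_additive.
- by move=> n; have := @measurable_rV_cons R d measurableT _ (mF n); rewrite setTI.
- apply/trivIsetP => /= i j _ _ ij; rewrite -preimage_setI.
  by move/trivIsetP : tF => /(_ _ _ _ _ ij) ->//; rewrite preimage_set0.
- rewrite -preimage_bigcup.
  by have := @measurable_rV_cons R d measurableT _ mUF; rewrite setTI.
Qed.

HB.instance Definition _ := isMeasure.Build _ _ _ lebesgue_step
  step0 step_ge0 step_sigma_additive.

Let step_sigma_finite : sigma_finite setT lebesgue_step.
Proof.
have /sigma_finiteP[F [TF ndF Foo]] := sigma_finiteT (@lebesgue_measure R).
have /sigma_finiteP[G [TG ndG Goo]] := sigma_finiteT nu.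
exists (fun n => @rV_split R d @^-1` (F n `*` G n)).
  apply/esym; rewrite -subTset => x _.
  have : setT (rV_split x).1 by []. rewrite TF => -[n _ Fn].
  have : setT (rV_split x).2 by []. rewrite TG => -[k _ Gk].
  exists (maxn n k) => //; split => /=.
  - by move: Fn; exact/subsetPset/ndF/leq_maxl.
  - by move: Gk; exact/subsetPset/ndG/leq_maxr.
move=> n; have [mF F_lty] := Foo n; have [mG G_lty] := Goo n.
have mFG : measurable (F n `*` G n) by exact: measurableX.
split; first by have := @measurable_rV_split R d measurableT _ mFG; rewrite setTI.
rewrite /lebesgue_step /pushforward -comp_preimage.
rewrite (_ : _ \o _ = id) ?preimage_id; last first.
  by apply/funext => p; exact: rV_consK.
by rewrite product_measure1E// lte_mul_pinfty// ge0_fin_numE.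
Qed.

HB.instance Definition _ := Measure_isSigmaFinite.Build _ _ _ lebesgue_step
  step_sigma_finite.
End lebesgue_step.

(* the product of d copies of the Lebesgue measure on R *)
Fixpoint lebesgue_rV (R : realType) (d : nat) :
    {sigma_finite_measure set 'rV[R]_d -> \bar R} :=
  match d with
  | 0 => @dirac _ 'rV[R]_0 0 R
  | d'.+1 => lebesgue_step (lebesgue_rV R d')
  end.

Section vector_calculus.
Context {R : realType} {d : nat}.
Implicit Types (u v w : 'rV[R]_3) (F G : 'rV[R]_d -> 'rV[R]_3).

Definition dot n (u v : 'rV[R]_n) : R := \sum_i u 0 i * v 0 i.

(* indices in 'I_3 are added modulo 3 *)
Definition cross u v : 'rV[R]_3 :=
  \row_k (u 0 (k + 1) * v 0 (k + 2%:R) - u 0 (k + 2%:R) * v 0 (k + 1)).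

(* The k-th coordinate direction of the physical space, seen in R^d: it is the
   zero vector when d <= k, so that 'D_(axis k) is then the zero operator. For
   d = 2 this is the convention that fields do not depend on z. *)
Definition axis (k : 'I_3) : 'rV[R]_d := \row_j (j == k :> nat)%:R.

Definition embed (n : 'rV[R]_d) : 'rV[R]_3 := \row_k dot n (axis k).

Definition planar (u : 'rV[R]_3) : 'rV[R]_d := \row_j u 0 (inord j).

Definition component F (k : 'I_3) : 'rV[R]_d -> R := fun x => F x 0 k.

Definition grad (f : 'rV[R]_d -> R) (x : 'rV[R]_d) : 'rV[R]_3 :=
  \row_k 'D_(axis k) f x.

Definition curl F (x : 'rV[R]_d) : 'rV[R]_3 :=
  \row_k ('D_(axis (k + 1)) (component F (k + 2%:R)) x
          - 'D_(axis (k + 2%:R)) (component F (k + 1)) x).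

Definition smooth (f : 'rV[R]_d -> R) :=
  forall (s : seq 'rV[R]_d) (x : 'rV[R]_d),
    differentiable (foldr (fun e (g : 'rV[R]_d -> R) => 'D_e g) f s) x.

Definition boundary (A : set 'rV[R]_d) : set 'rV[R]_d := closure A `\` A°.

Definition bounded_domain (A : set 'rV[R]_d) :=
  [/\ open A, connected A, bounded_set A & A !=set0].

(* A has a tangent hyperplane at x, with unit normal n pointing out of A. No
   such n exists at an edge or a corner of A. *)
Definition outward_normal (A : set 'rV[R]_d) (x n : 'rV[R]_d) :=
  dot n n = 1 /\
  forall e : R, 0 < e -> \forall y \near x,
    (dot (y - x) n < - (e * `|y - x|) -> A y) /\
    (e * `|y - x| < dot (y - x) n -> ~ closure A y).

End vector_calculus.

Section Hcurl.
Context {R : realType} {d : nat} (Omega : set 'rV[R]_d).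
Implicit Types F G H c : 'rV[R]_d -> 'rV[R]_3.
Local Notation leb := (lebesgue_rV R d).

Definition in_L2 F := forall k : 'I_3,
  measurable_fun Omega (component F k) /\
  leb.-integrable Omega (fun x => (component F k x ^+ 2)%:E).

Definition ipL2 F G : R := \int[leb]_(x in Omega) dot (F x) (G x).

Definition normL2 F : R := Num.sqrt (ipL2 F F).

Definition test_field F :=
  (forall k, smooth (component F k)) /\
  exists A, [/\ compact A, A `<=` Omega & forall x, ~ A x -> F x = 0].

(* c is a representative of the distributional curl of H *)
Definition weak_curl H c :=
  [/\ in_L2 H, in_L2 c &
      forall F, test_field F -> ipL2 c F = ipL2 H (curl F)].

Definition in_Hcurl H := exists c, weak_curl H c.

End Hcurl.

Section reference_simplex.
Context {R : realType} {d : nat}.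

(* barycentric coordinates; the coordinate 0 belongs to the origin *)
Definition bary (x : 'rV[R]_d) (a : 'I_d.+1) : R :=
  if unlift ord0 a is Some j then x 0 j else 1 - \sum_j x 0 j.

Definition Khat : set 'rV[R]_d := [set x | forall a, 0 <= bary x a].

Definition Kvertex (a : 'I_d.+1) : 'rV[R]_d := \row_j (a == lift ord0 j)%:R.

Definition Kface (A : {set 'I_d.+1}) : set 'rV[R]_d :=
  [set x | Khat x /\ forall a, a \notin A -> bary x a = 0].

Definition Kfacet (a : 'I_d.+1) : set 'rV[R]_d := Kface [set~ a].

Definition poly_fun (k : nat) (p : 'rV[R]_d -> R) :=
  exists c : {ffun 'I_d -> 'I_k.+1} -> R, forall x,
    p x = \sum_(a : {ffun 'I_d -> 'I_k.+1} | (\sum_i a i <= k)%N)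
            c a * \prod_i x 0 i ^+ a i.

Definition poly_on (k : nat) (A : set 'rV[R]_d) (f : 'rV[R]_d -> R) :=
  exists2 p, poly_fun k p & forall x, A x -> f x = p x.

Definition C1_on (U : set 'rV[R]_d) (f : 'rV[R]_d -> 'rV[R]_d) :=
  forall x, U x ->
    differentiable f x /\ forall v, {for x, continuous ('D_v f)}.

(* A diffeomorphism of the closed set A onto its image is the restriction of a
   C^1 diffeomorphism between open neighbourhoods. *)
Definition diffeo_on (A : set 'rV[R]_d) (f : 'rV[R]_d -> 'rV[R]_d) :=
  exists U V (g : 'rV[R]_d -> 'rV[R]_d),
    [/\ open U /\ open V, A `<=` U, C1_on U f /\ C1_on V g,
        forall x, U x -> V (f x) /\ g (f x) = x &
        forall y, V y -> U (g y) /\ f (g y) = y].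

End reference_simplex.

(* geo K is the map T_K from the reference simplex to the cell K, node i the
   point x_i and hat i the nodal function phi_i. *)
Record fe_mesh (R : realType) (d : nat) := FEMesh {
  Omega : set 'rV[R]_d ;
  cell : finType ;
  geo : cell -> 'rV[R]_d -> 'rV[R]_d ;
  vertex : finType ;
  node : vertex -> 'rV[R]_d ;
  hat : vertex -> 'rV[R]_d -> R
}.

Section fe_spaces.
Context {R : realType} {d : nat} (M : fe_mesh R d).
Local Notation leb := (lebesgue_rV R d).
Local Notation Omega := (Omega M).

Definition element (K : cell M) : set 'rV[R]_d := geo K @` Khat.

Definition conforming_simplicial_mesh :=
  [/\ forall K : cell M, diffeo_on Khat (geo K),
      closure Omega = \bigcup_(K in [set: cell M]) element K,
      forall K L : cell M, K != L -> (element K)° `&` (element L)° = set0 &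
      forall K L : cell M, K != L -> exists A B : {set 'I_d.+1},
        element K `&` element L = geo K @` Kface A /\
        element K `&` element L = geo L @` Kface B].

(* Members of the finite element spaces are total functions of which only the
   restriction to the closure of Omega matters. *)
Definition in_Vh (v : 'rV[R]_d -> R) :=
  {within Omega, continuous v} /\
  forall K : cell M, poly_on 1 Khat (v \o geo K).

Definition in_Vh3 (v : 'rV[R]_d -> 'rV[R]_3) := forall k, in_Vh (component v k).

Definition nodal_basis :=
  [/\ injective (@node _ _ M),
      range (@node _ _ M) =
        [set x | exists (K : cell M) a, x = geo K (Kvertex a)],
      forall i, in_Vh (hat (f:=M) i) &
      forall i j, hat (f:=M) i (node j) = (i == j)%:R].

(* Since 'J f x i j is the i-th partial derivative of the j-th component of f,
   ('J f x)^T acting on row vectors is the transposed gradient of f acting on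
   column vectors. A field of H(curl) is multivalued on the faces of the mesh,
   so its pull-back is only prescribed in the interior of Khat. *)
Definition pull_back (K : cell M) (H : 'rV[R]_d -> 'rV[R]_3)
    (x : 'rV[R]_d) : 'rV[R]_d :=
  planar (H (geo K x)) *m ('J (geo K) x)^T.

Definition in_Hh (H : 'rV[R]_d -> 'rV[R]_3) :=
  [/\ in_Hcurl Omega (fun x => embed (planar (H x) : 'rV[R]_d)),
      forall (K : cell M) (j : 'I_d),
        poly_on 1 (Khat°) (fun x => pull_back K H x 0 j) &
      forall k : 'I_3, (d <= k)%N -> in_Vh (component H k)].

(* H x n = 0 on the boundary facets, for the trace of H from the cell *)
Definition tangential_trace0 (H : 'rV[R]_d -> 'rV[R]_3) :=
  forall (K : cell M) (a : 'I_d.+1),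
    geo K @` Kfacet a `<=` boundary Omega ->
    forall x n, (geo K @` Kfacet a) x -> outward_normal Omega x n ->
      cross (H y) (embed n) @[y --> within (element K)° (nbhs x)] --> (0 : 'rV[R]_3).

Definition in_Hh0 (H : 'rV[R]_d -> 'rV[R]_3) := in_Hh H /\ tangential_trace0 H.

Definition in_Ph (w : 'rV[R]_d -> R) :=
  {within Omega, continuous w} /\
  forall K : cell M, poly_on 2 Khat (w \o geo K).

Definition in_Ph0 (w : 'rV[R]_d -> R) :=
  in_Ph w /\ forall x, boundary Omega x -> w x = 0.

Definition lumped_mass (i : vertex M) : R :=
  \int[leb]_(x in Omega) hat i x.

Definition fe_scal (a : vertex M -> R) (x : 'rV[R]_d) : R :=
  \sum_i a i * hat i x.

Definition fe_vec (a : vertex M -> 'rV[R]_3) (x : 'rV[R]_d) : 'rV[R]_3 :=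
  \sum_i hat i x *: a i.

Definition lumped_ip (rho : vertex M -> R) (v w : 'rV[R]_d -> 'rV[R]_3) : R :=
  \sum_i lumped_mass i * rho i * dot (v (node i)) (w (node i)).

End fe_spaces.

Record hydro (R : realType) (V : finType) := Hydro {
  rho : V -> R ;
  mom : V -> 'rV[R]_3 ;
  ene : V -> R
}.

Section source_update.
Context {R : realType} {d : nat} (M : fe_mesh R d).
Local Notation leb := (lebesgue_rV R d).
Local Notation Omega := (Omega M).
Local Notation hydro := (hydro R (vertex M)).

(* cH is the curl of (H1 + H2) / 2; curls being defined up to null sets, the
   weak form is required for every representative cxi of the curl of xi. *)
Definition source_update (mu di : R) (r : 'rV[R]_d -> R)
    (u1 : hydro) (H1 : 'rV[R]_d -> 'rV[R]_3) (tau : R)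
    (u2 : hydro) (H2 : 'rV[R]_d -> 'rV[R]_3) : Prop :=
  exists v2 cH : 'rV[R]_d -> 'rV[R]_3,
  let v1 := fe_vec (fun i => (rho u1 i)^-1 *: mom u1 i) in
  let vbar := fun x => 2^-1 *: (v1 x + v2 x) in
  let Hbar := fun x => 2^-1 *: (H1 x + H2 x) in
  let J := fun i => (lumped_mass i)^-1 *
    \int[leb]_(x in Omega) (r x * dot (cH x) (cH x) * hat i x) in
  [/\ in_Vh3 M v2 /\ in_Hh0 M H2,
      weak_curl Omega Hbar cH,
      forall w, in_Vh3 M w ->
        lumped_ip (rho u1) (fun x => v2 x - v1 x) w
        - tau * mu * ipL2 Omega (fun x => cross (cH x) (Hbar x)) w = 0,
      forall xi cxi, in_Hh0 M xi -> weak_curl Omega xi cxi ->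
        mu * ipL2 Omega (fun x => H2 x - H1 x) xi
        + tau * mu * ipL2 Omega (fun x => cross (cxi x) (Hbar x)) vbar
        + tau * ipL2 Omega (fun x => r x *: cH x) cxi
        + tau * mu * di * ipL2 Omega
            (fun x => (fe_scal (rho u1) x)^-1 *: cross (cH x) (Hbar x)) cxi = 0 &
      forall i, [/\ rho u2 i = rho u1 i,
        mom u2 i = rho u1 i *: v2 (node i) &
        ene u2 i = ene u1 i
          + 2^-1 * (dot (mom u2 i) (mom u2 i) / rho u1 i)
          - 2^-1 * (dot (mom u1 i) (mom u1 i) / rho u1 i)
          + tau * J i]].

End source_update.

(* A possibly partial procedure: None means that it cannot be executed.
   euler_auto determines the time step, euler_with uses a supplied one. *)
Record euler_procedure (R : realType) (V : finType) := EulerProcedure {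
  euler_auto : hydro R V -> option (hydro R V * R) ;
  euler_with : hydro R V -> R -> option (hydro R V) ;
  euler_dt_gt0 : forall u u' tau, euler_auto u = Some (u', tau) -> 0 < tau
}.

Section euler_properties.
Context {R : realType} {V : finType}.
Implicit Types (P : euler_procedure R V) (u : hydro R V).

Definition euler_step P u u' :=
  (exists tau, euler_auto P u = Some (u', tau)) \/
  (exists2 tau, 0 < tau & euler_with P u tau = Some u').

Definition conservative (m : V -> R) P := forall u u', euler_step P u u' ->
  [/\ \sum_i m i * rho u' i = \sum_i m i * rho u i,
      \sum_i m i *: mom u' i = \sum_i m i *: mom u i &
      \sum_i m i * ene u' i = \sum_i m i * ene u i].

Definition admissible u := forall i, 0 < rho u i /\
  0 < ene u i - (2 * rho u i)^-1 * dot (mom u i) (mom u i).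

Definition preserves_admissible P := forall u u', euler_step P u u' ->
  admissible u -> admissible u'.

Definition internal_energy u (i : V) : R :=
  ene u i / rho u i - dot (mom u i) (mom u i) / (2 * rho u i ^+ 2).

Definition thermo u (i : V) : R * R := ((rho u i)^-1, internal_energy u i).

Definition math_entropy (s : R * R -> R) u (i : V) : R := - rho u i * s (thermo u i).

Definition entropy_dissipative (s : R * R -> R) (D : set (R * R)) (m : V -> R) P :=
  forall u u', euler_step P u u' ->
    (forall i, D (thermo u i)) -> (forall i, D (thermo u' i)) ->
    \sum_i m i * math_entropy s u' i <= \sum_i m i * math_entropy s u i.

End euler_properties.

Section equation_of_state.
Context {R : realType}.
Implicit Types (s : R * R -> R) (D U : set (R * R)).

Definition C2_on U s := forall p, U p ->
  [/\ differentiable s p,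
      forall w, differentiable ('D_w s) p &
      forall w w', {for p, continuous ('D_w ('D_w' s))}].

Definition dirv : R * R := (1, 0).
Definition dire : R * R := (0, 1).

(* D need not be open: s is C^2 on a neighbourhood of D *)
Definition equation_of_state s D :=
  [/\ convex_set (D : set (convex_lmodType (R * R)%type)),
      forall p, D p -> 0 < p.1 /\ 0 < p.2,
      exists U, [/\ open U, D `<=` U & C2_on U s],
      forall p, D p -> 0 < 'D_dire s p &
      forall p, D p ->
        [/\ 'D_dirv ('D_dirv s) p <= 0, 'D_dire ('D_dire s) p <= 0 &
            0 <= 'D_dirv ('D_dirv s) p * 'D_dire ('D_dire s) p
                 - ('D_dirv ('D_dire s) p) ^+ 2]].

End equation_of_state.

Section hall_mhd_update.
Context {R : realType} {d : nat} (M : fe_mesh R d).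
Local Notation hydro := (hydro R (vertex M)).

Definition hall_mhd_update (mu di : R) (r : 'rV[R]_d -> R)
    (P : euler_procedure R (vertex M))
    (un : hydro) (Hn : 'rV[R]_d -> 'rV[R]_3) (tau : R) (u1 u2 : hydro)
    (un1 : hydro) (Hn1 : 'rV[R]_d -> 'rV[R]_3) : Prop :=
  [/\ euler_auto P un = Some (u1, tau),
      forall i, 0 < rho u1 i,
      source_update mu di r u1 Hn (2 * tau) u2 Hn1 &
      euler_with P u2 tau = Some un1].

End hall_mhd_update.

(* Main.v *)
Require Import Defs.
From HB Require Import structures.
From mathcomp Require Import all_boot all_order all_algebra.
From mathcomp Require Import all_classical all_reals all_analysis.
From mathcomp Require Import measurable_realfun.
From mathcomp Require Import ring lra.
Set Implicit Arguments.
Unset Strict Implicit.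
Unset Printing Implicit Defensive.
Import Order.TTheory GRing.Theory Num.Theory.
Import numFieldNormedType.Exports.
Local Open Scope classical_set_scope.
Local Open Scope ring_scope.

(** Only the source step needs an argument: by assumption the Euler steps conserve
    the total energy, keep the states admissible and do not increase the
    mathematical entropy, and the magnetic field is changed by the source step
    alone, which in turn keeps the densities.

    Energy. The momentum equation is tested with the midpoint velocity and the
    magnetic equation with the midpoint field. The work of the Lorentz force is the
    same integral in both and cancels, and the Hall term is orthogonal to the
    current. The magnetic energy lost to resistivity is the integral of
    $r |\mathrm{curl}\, H|^2$, and since the nodal functions are a partition of
    unity it is the sum of the Joule heats given to the nodes
    ([source_update_energy]).

    Admissibility and entropy. The nodal functions are affine in the reference
    simplex with vertex values 0 and 1, hence nonnegative; so are the Joule heats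
    ([source_update_heating]). The source step can thus only raise the internal
    energy at fixed density, which keeps the states admissible and, as the specific
    entropy increases with the internal energy, does not increase the mathematical
    entropy ([entropy_nondecreasing]).

    Involution. When [grad w] is taken as test field in the magnetic equation, with
    zero as its weak curl, all terms but the time increment vanish. This requires
    two facts. First, [grad w] is an edge element field with zero tangential trace
    ([grad_in_Hh0]): its pull-back is the gradient of a quadratic polynomial, and on
    a boundary facet it is parallel to the normal because both annihilate the
    tangent directions. Second, its weak curl is zero ([weak_curl_grad]). For this,
    [w] is extended by zero to a function that is piecewise [C^1] with respect to a
    finite closed cover of the space (the cells and the complement of the domain).
    Such a function is globally Lipschitz ([piecewise_C1_lipschitz]) and has almost
    everywhere a derivative in each direction ([piecewise_C1_derivable_ae]): the
    exceptional points are transversal zeros of the difference of two pieces, and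
    they form a null set because its small translates along the direction are
    disjoint. Finally $\int \partial_a w\, \partial_b f$ is symmetric in the
    directions [a] and [b] for a Lipschitz [w] and a regular [f] of bounded support
    ([integral_derive_swap]): for difference quotients this is translation
    invariance of the Lebesgue measure, and dominated convergence does the rest. *)

(** * Lebesgue measure on row vectors *)

Lemma coord_norm_le (R : realType) n (x : 'rV[R]_n) i : `|x 0 i| <= `|x|.
Proof.
rewrite [leRHS]/Num.Def.normr /= mx_normrE.
by apply/bigmax_geP; right; exists (0, i).
Qed.

Lemma norm_rV_lt (R : realType) n (x : 'rV[R]_n) (e : R) : 0 < e ->
  (forall i, `|x 0 i| < e) -> `|x| < e.
Proof.
move=> e0 xe; rewrite [ltLHS]/Num.Def.normr /= mx_normrE; apply/bigmax_ltP; split => //.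
by move=> [i j] _ /=; rewrite (ord1 i).
Qed.

Lemma norm_rV_le (R : realType) n (x : 'rV[R]_n) (e : R) : 0 <= e ->
  (forall i, `|x 0 i| <= e) -> `|x| <= e.
Proof.
move=> e0 xe; rewrite [leLHS]/Num.Def.normr /= mx_normrE; apply/bigmax_leP; split => //.
by move=> [i j] _ /=; rewrite (ord1 i).
Qed.

Section borel.
Context {R : realType} {d : nat}.
Implicit Types (U : set 'rV[R]_d) (f : 'rV[R]_d -> R).

(** The boxes with rational centre and side are a countable basis of the topology. *)
Definition rat_box (p : 'rV[rat]_d * nat) : set 'rV[R]_d :=
  [set x | forall i, `|x 0 i - ratr (p.1 0 i)| < p.2.+1%:R^-1].

Lemma measurable_rat_box p : measurable (rat_box p).
Proof.
rewrite (_ : rat_box p = \bigcap_(i in [set: 'I_d])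
    ((fun x : 'rV[R]_d => x 0 i : measurableTypeR R) @^-1`
       ball (ratr (p.1 0 i) : R) p.2.+1%:R^-1)).
  apply: fin_bigcap_measurable => // i _.
  rewrite -[X in measurable X]setTI.
  apply: (@measurable_coord R d i measurableT).
  exact: measurable_ball.
apply/seteqP; split => x /= h.
  by move=> i _ /=; rewrite /ball /= distrC.
by move=> i; rewrite distrC; exact: (h i I).
Qed.

Lemma rat_box_nbhs (x : 'rV[R]_d) (U : set 'rV[R]_d) : nbhs x U ->
  exists2 p, rat_box p x & rat_box p `<=` U.
Proof.
move=> /nbhs_ballP[e /= e0 xeU].
have [n ne] : exists n, n.+1%:R^-1 + n.+1%:R^-1 < e.
  have e20 : 0 < e / 2 by rewrite divr_gt0.
  have [N _ /(_ N (leqnn N)) /= h] := near_infty_natSinv_lt (PosNum e20).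
  by exists N; rewrite (splitr e) ltrD.
have /choice[q qP] : forall i : 'I_d, exists q : rat, `|x 0 i - ratr q| < n.+1%:R^-1.
  move=> i; have /rat_in_itvoo[q /itvP qi] :
    x 0 i - n.+1%:R^-1 < x 0 i + n.+1%:R^-1 :> R.
    by rewrite ltrD2l gtrN// invr_gt0.
  by exists q; rewrite ltr_distlC !qi.
exists (\row_i q i, n); first by move=> i; rewrite mxE.
move=> y yq; apply: xeU; rewrite mx_norm_ball /ball_ /=.
apply: norm_rV_lt => // i; rewrite !mxE.
apply: lt_trans ne.
rewrite (_ : x 0 i - y 0 i = (x 0 i - ratr (q i)) + (ratr (q i) - y 0 i)); last by ring.
apply: le_lt_trans (ler_normD _ _) _; apply: ltrD => //.
by rewrite distrC; have := yq i; rewrite mxE.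
Qed.

Lemma open_measurable_rV U : open U -> measurable U.
Proof.
move=> oU; rewrite (_ : U = \bigcup_(p in [set: 'rV[rat]_d * nat])
   (if `[< rat_box p `<=` U >] then rat_box p else set0)).
  apply: countable_bigcupT_measurable => // p.
  by case: ifP => // _; exact: measurable_rat_box.
apply/seteqP; split => x.
  move=> Ux; have [p xp pU] := rat_box_nbhs (open_nbhs_nbhs (conj oU Ux)).
  by exists p => //; rewrite asboolT.
by move=> [p _]; case: asboolP => // pU; exact: pU.
Qed.

Lemma closed_measurable_rV U : closed U -> measurable U.
Proof.
move=> cU; rewrite -[U]setCK; apply: measurableC; apply: open_measurable_rV.
exact: closed_openC.
Qed.

(** Preimages of open intervals are open, hence Borel for the product
    sigma-algebra. *)
Lemma continuous_on_open_measurable U f : open U ->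
  {in U, continuous f} -> measurable_fun U f.
Proof.
move=> oU cf mU; apply: (measurability _ (RGenOpens.measurableE R)) => //.
move=> _ [_ [a [b ->] <-]]; apply: open_measurable_rV.
rewrite openE => x [Ux fx]; apply: filterI; first exact: open_nbhs_nbhs.
apply: (cf x (mem_set Ux)); apply: open_nbhs_nbhs; split => //.
Qed.

Lemma continuous_measurable_rV f : continuous f -> measurable_fun setT f.
Proof.
move=> cf; apply: continuous_on_open_measurable; first exact: openT.
by move=> x _; exact: cf.
Qed.

End borel.

Section lebesgue_rV_theory.
Context {R : realType}.
Local Open Scope ereal_scope.

Lemma lebesgue_measure_shift (c : R) (A : set R) : measurable A ->
  (@lebesgue_measure R) ((fun x => x + c)%R @^-1` A) = lebesgue_measure A.
Proof.
move=> mA.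
have ms : measurable_fun [set: measurableTypeR R] ((fun x => x + c)%R : _ -> measurableTypeR R).
  by apply: continuous_measurable_fun => x; apply: cvgD; [exact: cvg_id|exact: cvg_cst].
transitivity (pushforward (@lebesgue_measure R) ((fun x => x + c)%R : _ -> measurableTypeR R) A) => //.
apply/esym/lebesgue_measure_unique => //= _ [[a b]] _ <-.
rewrite /pushforward.
rewrite (_ : _ @^-1` _ = `](a - c)%R, (b - c)%R]%classic); last first.
  by apply/seteqP; split => x /=; rewrite !in_itv/= ltrBlDr lerBrDr.
rewrite !lebesgue_measure_itv/= !lte_fin ltrD2r; case: ifP => // _.
by rewrite -!EFinB; congr (_%:E); ring.
Qed.

Lemma measurable_shift d (c : 'rV[R]_d) : measurable_fun setT (fun x : 'rV[R]_d => (x + c)%R).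
Proof.
apply: measurable_fun_rV => i.
rewrite (_ : (fun x => _) = (fun x : 'rV[R]_d => x ord0 i) \+ (fun=> c ord0 i))%R.
  apply: (@measurable_funD _ _ _ _ (fun x : 'rV[R]_d => x ord0 i) (fun=> c ord0 i)) => //.
  exact: measurable_coord.
by apply/funext => x; rewrite mxE.
Qed.

(** By induction on the dimension: the product with a translated factor agrees with
    the original measure on rectangles, and rectangles determine a product measure. *)
Lemma lebesgue_rV_shift d (c : 'rV[R]_d) (A : set 'rV[R]_d) : measurable A ->
  lebesgue_rV R d ((fun x => x + c)%R @^-1` A) = lebesgue_rV R d A.
Proof.
elim: d c A => [|d IH] c A mA.
  congr (lebesgue_rV R 0 _); apply/seteqP; split => x /=.
    by rewrite (_ : x + c = x)%R//; apply/rowP => -[].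
  by rewrite (_ : x + c = x)%R//; apply/rowP => -[].
rewrite /= /lebesgue_step /pushforward.
pose c' : 'rV[R]_d := \row_j c 0%R (lift ord0 j).
pose sh (p : measurableTypeR R * 'rV[R]_d) : measurableTypeR R * 'rV[R]_d :=
  (p.1 + c 0 ord0, p.2 + c')%R.
have msh : measurable_fun setT sh.
  apply/measurable_fun_pairP; split => /=.
    apply: (@measurableT_comp _ _ _ _ _ _
      (fun x : measurableTypeR R => (x + c 0 ord0)%R : measurableTypeR R) _
      (@fst (measurableTypeR R) 'rV[R]_d)); last exact: measurable_fst.
    by apply: continuous_measurable_fun => x; apply: cvgD; [exact: cvg_id|exact: cvg_cst].
  exact: (measurableT_comp (measurable_shift c') measurable_snd).
have mB : measurable (@rV_cons R d @^-1` A).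
  by rewrite -[X in measurable X]setTI; exact: measurable_rV_cons.
transitivity (pushforward (@lebesgue_measure R \x lebesgue_rV R d) sh (@rV_cons R d @^-1` A)).
  rewrite /pushforward; congr (product_measure1 _ _ _).
  apply/seteqP; split => -[t y] /=.
    rewrite (_ : rV_cons (t, y) + c = rV_cons (sh (t, y)))%R//.
    apply/rowP => i; rewrite !mxE; case: unliftP => [j ->|->] //=.
    by rewrite !mxE.
  rewrite (_ : rV_cons (t, y) + c = rV_cons (sh (t, y)))%R//.
  apply/rowP => i; rewrite !mxE; case: unliftP => [j ->|->] //=.
  by rewrite !mxE.
apply/esym/product_measure_unique => //= E F mE mF.
rewrite /pushforward.
rewrite (_ : sh @^-1` _ = ((fun x => x + c 0 ord0)%R @^-1` E) `*` ((fun x => x + c')%R @^-1` F))//.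
have ms : measurable_fun [set: measurableTypeR R] ((fun x => x + c 0%R ord0)%R : _ -> measurableTypeR R).
  by apply: continuous_measurable_fun => x; apply: cvgD; [exact: cvg_id|exact: cvg_cst].
rewrite product_measure1E//.
- by rewrite IH//; congr (_ * _); exact: lebesgue_measure_shift.
- by rewrite -[X in measurable X]setTI; exact: ms.
- by rewrite -[X in measurable X]setTI; exact: measurable_shift.
Qed.

Lemma measurable_box d (r : R) :
  measurable [set x : 'rV[R]_d | forall i, `|x 0%R i| <= r]%R.
Proof.
rewrite (_ : mkset _ = \bigcap_(i in [set: 'I_d])
    ((fun x : 'rV[R]_d => x 0%R i : measurableTypeR R) @^-1` `[(- r)%R, r]%classic)).
  apply: fin_bigcap_measurable => // i _.
  rewrite -[X in measurable X]setTI.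
  apply: (@measurable_coord R d i measurableT).
  exact: measurable_itv.
apply/seteqP; split => x /= h.
  by move=> i _ /=; rewrite in_itv/= -ler_norml.
by move=> i; have := h i I; rewrite /= in_itv/= -ler_norml.
Qed.

Lemma lebesgue_rV_box_lty d (r : R) :
  lebesgue_rV R d [set x | forall i, `|x 0%R i| <= r]%R < +oo.
Proof.
elim: d => [|d IH].
  by rewrite /= diracE; case: (_ \in _); rewrite ltry.
rewrite /= /lebesgue_step /pushforward.
rewrite (_ : _ @^-1` _ = `[(- r)%R, r]%classic `*`
    [set x : 'rV[R]_d | forall i, `|x 0%R i| <= r]%R); last first.
  apply/seteqP; split => -[t y] /=.
    move=> h; split.
      by have := h ord0; rewrite mxE unlift_none /= in_itv/= ler_norml.
    by move=> i; have := h (lift ord0 i); rewrite mxE liftK.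
  move=> [tr yr] i; rewrite mxE; case: unliftP => [j _|_] //=.
  by move: tr; rewrite in_itv/= ler_norml.
have mB := @measurable_box d r.
rewrite product_measure1E//.
have rfin : (@lebesgue_measure R) `[(- r)%R, r]%classic < +oo.
  by rewrite lebesgue_measure_itv/=; case: ifP => // _; rewrite -EFinB ltry.
apply: lte_mul_pinfty => //.
by rewrite ge0_fin_numE//; exact: measure_ge0.
Qed.

Lemma lebesgue_rV_bounded_lty d (A : set 'rV[R]_d) : measurable A ->
  bounded_set A -> lebesgue_rV R d A < +oo.
Proof.
move=> mA [M [Mr h]].
apply: le_lt_trans (lebesgue_rV_box_lty d (M + 1)).
have mB := @measurable_box d (M + 1).
apply: le_measure; rewrite ?inE// => x Ax i.
by apply: le_trans (coord_norm_le _ _) _; apply: h => //; rewrite ltrDl.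
Qed.

End lebesgue_rV_theory.

(** * Difference quotients and the symmetry of weak mixed derivatives *)

Section continuity_kit.
Context {R : realType} {T : topologicalType}.
Implicit Types (f g : T -> R).

Lemma cts_sub f g : continuous f -> continuous g -> continuous (fun x => f x - g x).
Proof. by move=> cf cg x; apply: cvgB; [exact: cf|exact: cg]. Qed.

Lemma cts_mul f g : continuous f -> continuous g -> continuous (fun x => f x * g x).
Proof. by move=> cf cg x; apply: cvgM; [exact: cf|exact: cg]. Qed.

Lemma cts_norm f : continuous f -> continuous (fun x => `|f x|).
Proof. by move=> cf x; apply: cvg_norm; exact: cf. Qed.

Lemma closed_sublevel f (c : R) : continuous f -> closed [set x | f x <= c].
Proof. by move=> cf; apply: (closed_comp _ (@closed_le R c)) => x _; exact: cf. Qed.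

End continuity_kit.

Lemma shift_continuous (R : realType) d (c : 'rV[R]_d) : continuous (fun x : 'rV[R]_d => x + c).
Proof.
by move=> x; apply: (@continuousD _ _ _ id (cst c)); [by move=> A|exact: cst_continuous].
Qed.

Lemma cts_shift (R : realType) d (f : 'rV[R]_d -> R) c :
  continuous f -> continuous (fun x : 'rV[R]_d => f (x + c)).
Proof.
by move=> cf x; apply: continuous_comp; [exact: shift_continuous|exact: cf].
Qed.

Section bounded_support.
Context {R : realType} {d : nat}.
Local Notation leb := (lebesgue_rV R d).
Implicit Types (f g w : 'rV[R]_d -> R) (a b c v : 'rV[R]_d).

Lemma measurable_norm_le (r : R) : measurable [set x : 'rV[R]_d | `|x| <= r].
Proof.
apply: closed_measurable_rV.
apply: (closed_comp _ (@closed_le R r)) => x _.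
exact: norm_continuous.
Qed.

(** Integrals over the whole space are used, rather than over a domain, so that
    translations act on them; bounded support replaces finiteness of the measure. *)
Lemma bounded_support_integrable (r C : R) g : measurable_fun setT g ->
  (forall x, `|g x| <= C) -> (forall x, r < `|x| -> g x = 0) ->
  leb.-integrable setT (EFin \o g).
Proof.
move=> mg gC g0.
have mB := measurable_norm_le r.
have -> : EFin \o g = (EFin \o g) \_ [set x | `|x| <= r].
  apply/funext => x; rewrite patchE; case: ifPn => // /negP xB /=.
  by rewrite g0// ltNge; apply/negP => /mem_set.
apply/integrable_restrict => //; rewrite setTI.
apply: measurable_bounded_integrable => //.
- apply: lebesgue_rV_bounded_lty => //.
  exists r; split; first exact: num_real.
  by move=> M rM x /= /le_trans; apply; exact: ltW.
- exact: measurable_funS mg.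
- exists C; split; first exact: num_real.
  by move=> M CM x _ /=; exact: le_trans (gC x) (ltW CM).
Qed.

Lemma continuous_support_integrable (r : R) g : continuous g ->
  (forall x, r < `|x| -> g x = 0) -> leb.-integrable setT (EFin \o g).
Proof.
move=> cg g0.
have cB : compact [set x : 'rV[R]_d | `|x| <= r].
  apply: bounded_closed_compact; last by apply: closed_sublevel; exact: norm_continuous.
  by exists r; split; [exact: num_real|move=> M rM x /= /le_trans; apply; exact: ltW].
have /compact_bounded[M [Mr gM]] :=
  continuous_compact (continuous_subspaceT cg) cB.
apply: (@bounded_support_integrable r (`|M| + 1)) => //.
  exact: continuous_measurable_rV.
move=> x; have [xr|rx] := leP `|x| r.
  by apply: (gM (`|M| + 1)); [rewrite ltr_pwDr// ler_norm|exists x].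
by rewrite g0// normr0 addr_ge0.
Qed.

Lemma integral_shift c f : leb.-integrable setT (EFin \o f) ->
  \int[leb]_x f (x + c) = \int[leb]_x f x.
Proof.
move=> fi; congr fine.
have mc := @measurable_shift R d (- c).
have mf : measurable_fun setT (fun x : 'rV[R]_d => (f (x + c))%:E).
  apply: (measurableT_comp (f := EFin \o f)); last exact: measurable_shift.
  exact: (measurable_int leb).
transitivity (\int[pushforward leb (fun x => x - c)%R]_x (f (x + c))%:E)%E.
  apply: eq_measure_integral => A mA _.
  by apply/esym; exact: lebesgue_rV_shift.
rewrite integral_pushforward//=.
  by apply: eq_integral => x _ /=; rewrite subrK.
rewrite preimage_setT (_ : _ \o _ = EFin \o f)//.
by apply/funext => x /=; rewrite subrK.
Qed.

End bounded_support.

Lemma lipschitz_continuous (R : realType) (V : normedModType R) (f : V -> R) (L : R) :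
  0 <= L -> (forall y z, `|f y - f z| <= L * `|y - z|) -> continuous f.
Proof.
move=> L0 fL x; apply/cvgrPdist_lt => e e0.
have L1 : 0 < L + 1 by rewrite ltr_wpDl.
apply/nbhs_normP; exists (e / (L + 1)) => /=; first by rewrite divr_gt0.
move=> y /= xy.
apply: le_lt_trans (fL _ _) _; rewrite ltr_pdivlMr// in xy.
by apply: le_lt_trans xy; rewrite mulrC ler_wpM2l// lerDl.
Qed.

Section difference_quotient.
Context {R : realType} {d : nat}.
Local Notation leb := (lebesgue_rV R d).
Implicit Types (f g w : 'rV[R]_d -> R) (a b c v : 'rV[R]_d).

(** For [h = 0] the quotient is zero, because [0^-1 = 0]; bounds on it therefore
    need no side condition on [h]. *)
Definition dquot f v (h : R) x := h^-1 * (f (x + h *: v) - f x).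

Lemma dquotE f v x : (fun h => h^-1 *: ((f \o shift x) (h *: v) - f x)) = dquot f v ^~ x.
Proof. by apply/funext => h; rewrite /dquot /= [h *: v + x]addrC. Qed.

Lemma derivable_dquot f v x : derivable f x v -> dquot f v h x @[h --> 0^'] --> 'D_v f x.
Proof. by rewrite /derivable /derive !dquotE. Qed.

Lemma dquot_derive f v x (l : R) : dquot f v h x @[h --> 0^'] --> l ->
  derivable f x v /\ 'D_v f x = l.
Proof.
rewrite /derivable /derive !dquotE => h; split; first by apply/cvg_ex; exists l.
exact: cvg_lim.
Qed.

Lemma cvg_harmonic_dnbhs : (@harmonic R) @ \oo --> (0 : R)^'.
Proof.
move=> A /(cvg_harmonic) [N _ NA]; exists N => // n /= Nn.
by apply: NA => //; rewrite gt_eqF// harmonic_gt0.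
Qed.

Lemma cvg_opp_dnbhs : (-%R : R -> R) @ (0 : R)^' --> (0 : R)^'.
Proof.
move=> A A0; rewrite /= nbhs_simpl.
have : \forall x \near (0 : R), -%R x != 0 -> A (- x).
  have : (-%R : R -> R) @ (0 : R) --> (0 : R).
    by rewrite -[X in _ --> X]oppr0; exact: opp_continuous.
  by move=> /(_ _ A0).
by apply: filterS => x h x0; apply: h; rewrite oppr_eq0.
Qed.

Lemma dquot_continuous f v h : continuous f -> continuous (dquot f v h).
Proof.
move=> cf; apply: cts_mul; first exact: cst_continuous.
by apply: cts_sub => //; exact: cts_shift.
Qed.

Definition lipschitz_with (L : R) f := 0 <= L /\ forall y z, `|f y - f z| <= L * `|y - z|.

Lemma lipschitz_with_continuous L f : lipschitz_with L f -> continuous f.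
Proof.
by move=> [L0 fL]; exact: lipschitz_continuous L0 fL.
Qed.

Lemma dquot_bound f v h x (L : R) : lipschitz_with L f ->
  `|dquot f v h x| <= L * `|v|.
Proof.
move=> [L0 fL]; rewrite /dquot normrM.
have [->|h0] := eqVneq h 0; first by rewrite invr0 normr0 mul0r mulr_ge0.
rewrite normfV ler_pdivrMl ?normr_gt0//; apply: le_trans (fL _ _) _.
by rewrite addrAC subrr add0r normrZ mulrCA.
Qed.

(** The derivative exists exactly where the difference quotients satisfy the Cauchy
    criterion. For fixed tolerances this criterion is an intersection, over all real
    steps, of closed sets, so the set of derivability is an intersection of countable
    unions of closed sets. *)
Lemma measurable_derivable f v : continuous f -> measurable [set x | derivable f x v].
Proof.
move=> cf.
pose C m n := [set x | forall h k : R, 0 < `|h| < n.+1%:R^-1 -> 0 < `|k| < n.+1%:R^-1 ->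
   `|dquot f v h x - dquot f v k x| <= m.+1%:R^-1].
have cC m n : closed (C m n).
  rewrite (_ : C m n = \bigcap_(p in [set p : R * R | 0 < `|p.1| < n.+1%:R^-1 /\
      0 < `|p.2| < n.+1%:R^-1]) [set x | `|dquot f v p.1 x - dquot f v p.2 x| <= m.+1%:R^-1]).
    apply: closed_bigI => p _.
    by apply: closed_sublevel; apply: cts_norm; apply: cts_sub; exact: dquot_continuous.
  apply/seteqP; split => x /=; first by move=> H [h k] /= [hn kn]; exact: H.
  by move=> H h k hn kn; exact: (H (h, k)).
rewrite (_ : mkset _ = \bigcap_m \bigcup_n C m n).
  apply: bigcapT_measurable => m; apply: bigcupT_measurable => n.
  exact: closed_measurable_rV.
apply/seteqP; split => x /=.
  move=> /derivable_dquot dfx m _.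
  have m0 : 0 < (m.+1%:R^-1 / 2 : R) by rewrite divr_gt0.
  have /cvgrPdist_lt/(_ _ m0)[e /= e0 H] := dfx.
  have [N _ /(_ N (leqnn N)) /= Ne] := near_infty_natSinv_lt (PosNum e0).
  exists N => // h k /andP[h0 hN] /andP[k0 kN].
  rewrite (_ : _ - _ = (dquot f v h x - 'D_v f x) + ('D_v f x - dquot f v k x)); last by ring.
  apply: le_trans (ler_normD _ _) _; rewrite (splitr m.+1%:R^-1).
  apply: lerD; apply: ltW; first rewrite distrC.
    apply: H; last by rewrite -normr_gt0.
    by rewrite /ball /= sub0r normrN (lt_trans hN).
  apply: H; last by rewrite -normr_gt0.
  by rewrite /ball /= sub0r normrN (lt_trans kN).
move=> H; rewrite /derivable dquotE.
apply/cauchy_cvgP; apply/cauchy_ballP => e e0.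
have [m _ /(_ m (leqnn m)) /= me] := near_infty_natSinv_lt (PosNum e0).
have [n _ Hn] := H m I.
have n0 : 0 < (n.+1%:R^-1 : R) by [].
exists ([set dquot f v h x | h in [set h : R | 0 < `|h| < n.+1%:R^-1]],
        [set dquot f v h x | h in [set h : R | 0 < `|h| < n.+1%:R^-1]]).
  split.
    exists n.+1%:R^-1 => //= h; rewrite /ball/= sub0r normrN => hn h0.
    by exists h => //; rewrite normr_gt0 h0.
  exists n.+1%:R^-1 => //= h; rewrite /ball/= sub0r normrN => hn h0.
  by exists h => //; rewrite normr_gt0 h0.
move=> [_ _] /= [[h hn <-] [k kn <-]].
by rewrite /ball /=; apply: le_lt_trans (Hn _ _ hn kn) me.
Qed.

(** On the set of derivability the derivative is a limit of continuous difference
    quotients; off it, the derivative is the constant default value of a limit. *)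
Lemma measurable_derive f v : continuous f -> measurable_fun setT ('D_v f).
Proof.
move=> cf; have mE := measurable_derivable v cf.
rewrite -(setvU [set x | derivable f x v]) setUC.
apply/measurable_funU => //; first exact: measurableC.
split.
  apply: (measurable_fun_cvg (h := fun n => dquot f v (harmonic n))).
    move=> n; apply: measurable_funS (continuous_measurable_rV _) => //.
    exact: dquot_continuous.
  move=> x /= /derivable_dquot dfx.
  exact: cvg_comp cvg_harmonic_dnbhs dfx.
apply: (eq_measurable_fun (cst (point : R))) => //.
move=> x /set_mem /= nd; rewrite /derive dvgP//.
Qed.

Lemma derive_bound f v x (L : R) : lipschitz_with L f ->
  `|'D_v f x| <= L * `|v|.
Proof.
move=> fL; have L0 := fL.1; have [/derivable_dquot df|nd] := pselect (derivable f x v); last first.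
  rewrite /derive dvgP// (_ : point = 0)// normr0; exact: mulr_ge0.
apply: (@closed_cvg _ _ _ _ _ (fun y => `|y| <= L * `|v|) _ _ _ df).
  apply: (closed_comp _ (@closed_le R _)) => y _; exact: norm_continuous.
by apply: nearW => h; exact: dquot_bound.
Qed.

Lemma dquot_prod_integrable w f a b (M h k : R) : continuous w -> continuous f ->
  (forall x, M < `|x| -> f x = 0) ->
  leb.-integrable setT (EFin \o (fun x => dquot w a h x * dquot f b k x)).
Proof.
move=> cw cf f0; apply: (@continuous_support_integrable _ _ (M + `|k *: b|)).
  by apply: cts_mul; exact: dquot_continuous.
move=> x Mx; have fx : f x = 0 by apply: f0; apply: le_lt_trans Mx; rewrite lerDl.
have fy : f (x + k *: b) = 0.
  apply: f0; have := ler_normB (x + k *: b) (k *: b); rewrite addrK => xe.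
  by rewrite -(ltrD2r `|k *: b|); exact: lt_le_trans xe.
by rewrite {2}/dquot fx fy subrr !mulr0.
Qed.

(** Expanding the product gives four terms of the form
    $\int w(x+c) f(x+e)$, and translation invariance turns each into a function of
    $c-e$ only. The forward quotient of [w] and the backward quotient of [f] then
    combine into an expression symmetric in [a] and [b]. *)
Lemma integral_dquot_swap w f a b (M h : R) : continuous w -> continuous f ->
  (forall x, M < `|x| -> f x = 0) ->
  \int[leb]_x (dquot w a h x * dquot f b (- h) x) =
  \int[leb]_x (dquot w b h x * dquot f a (- h) x).
Proof.
move=> cw cf f0.
pose F c e x := w (x + c) * f (x + e).
have Fi c e : leb.-integrable setT (EFin \o F c e).
  apply: (@continuous_support_integrable _ _ (M + `|e|)).
    by apply: cts_mul; exact: cts_shift.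
  move=> x Mx; rewrite /F f0 ?mulr0//.
  have := ler_normB (x + e) e; rewrite addrK => xe.
  by rewrite -(ltrD2r `|e|); exact: lt_le_trans xe.
have FE c e : \int[leb]_x F c e x = \int[leb]_x F (c - e) 0 x.
  rewrite -(@integral_shift _ _ e (F (c - e) 0))//.
  apply: eq_Rintegral => x _; rewrite /F addr0; congr (w _ * _).
  by rewrite [c - e]addrC addrA addrK.
have TE u v : \int[leb]_x (dquot w u h x * dquot f v (- h) x) =
    - (h^-1 ^+ 2) * (\int[leb]_x F (h *: u + h *: v) 0 x - \int[leb]_x F (h *: u) 0 x
      - \int[leb]_x F (h *: v) 0 x + \int[leb]_x F 0 0 x).
  have -> : \int[leb]_x F (h *: u + h *: v) 0 x = \int[leb]_x F (h *: u) (- (h *: v)) x.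
    by rewrite [RHS]FE opprK.
  have -> : \int[leb]_x F (h *: v) 0 x = \int[leb]_x F 0 (- (h *: v)) x.
    by rewrite [RHS]FE opprK add0r.
  rewrite -RintegralB//.
  rewrite -RintegralB//; last exact: (integrableB _ (Fi _ _) (Fi _ _)).
  rewrite -RintegralD//; last first.
    exact: (integrableB _ (integrableB _ (Fi _ _) (Fi _ _)) (Fi _ _)).
  rewrite -RintegralZl//; last first.
    exact: (integrableD _ (integrableB _ (integrableB _ (Fi _ _) (Fi _ _)) (Fi _ _)) (Fi _ _)).
  apply: eq_Rintegral => x _; rewrite /dquot /F scaleNr !addr0 invrN.
  ring.
by rewrite !TE [h *: b + _]addrC; ring.
Qed.

(** Dominated convergence: the quotients are bounded by the Lipschitz constants, and
    for steps at most 1 the support of the quotient of [f] stays in a fixed ball. *)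
Lemma integral_dquot_cvg w f a b (Lw Lf M : R) :
  lipschitz_with Lw w -> lipschitz_with Lf f -> (forall x, M < `|x| -> f x = 0) ->
  {ae leb, forall x, derivable w x a} -> (forall x, derivable f x b) ->
  (\int[leb]_x (dquot w a (harmonic n) x * dquot f b (- harmonic n) x)%:E)%E @[n --> \oo] -->
  (\int[leb]_x ('D_a w x * 'D_b f x)%:E)%E.
Proof.
move=> wL fL f0 dw df.
have cw := lipschitz_with_continuous wL; have cf := lipschitz_with_continuous fL.
pose r := M + `|b|; pose C := Lw * `|a| * (Lf * `|b|).
have C0 : 0 <= C by rewrite !mulr_ge0//; [exact: wL.1|exact: fL.1].
pose G : 'rV[R]_d -> R := fun x => C * \1_[set x : 'rV[R]_d | `|x| <= r] x.
have mB := measurable_norm_le (d := d) r.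
have mfn n : measurable_fun setT
    (fun x => (dquot w a (harmonic n) x * dquot f b (- harmonic n) x)%:E).
  apply/measurable_EFinP; apply: continuous_measurable_rV.
  by apply: cts_mul; exact: dquot_continuous.
have mf : measurable_fun setT (fun x => ('D_a w x * 'D_b f x)%:E).
  by apply/measurable_EFinP; apply: measurable_funM; exact: measurable_derive.
have cvgf : {ae leb, forall x, setT x ->
    (dquot w a (harmonic n) x * dquot f b (- harmonic n) x)%:E @[n --> \oo] -->
    ('D_a w x * 'D_b f x)%:E}.
  apply: filterS dw => x dwx _; apply: cvg_EFin; first exact: nearW.
  apply: cvgM.
    exact: cvg_comp cvg_harmonic_dnbhs (derivable_dquot dwx).
  apply: (@cvg_comp _ _ _ (@harmonic R) (fun h => dquot f b (- h) x) _ _ _ cvg_harmonic_dnbhs).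
  exact: (@cvg_comp _ _ _ -%R (fun h => dquot f b h x) _ _ _ cvg_opp_dnbhs (derivable_dquot (df x))).
have iG : leb.-integrable setT (EFin \o G).
  apply: (@bounded_support_integrable _ _ r C).
  + by apply: measurable_funM => //; exact: measurable_indic.
  + by move=> x; rewrite /G indicE; case: (x \in _); rewrite ?mulr1 ?mulr0 ?normr0// ger0_norm.
  + move=> x rx; rewrite /G indicE memNset ?mulr0//= => xr.
    by move: rx; rewrite ltNge xr.
have fG : {ae leb, forall x n, setT x ->
    (`|(dquot w a (harmonic n) x * dquot f b (- harmonic n) x)%:E| <= (EFin \o G) x)%E}.
  apply: aeW => x n _; rewrite /= lee_fin normrM /G indicE.
  have [xr|rx] := leP `|x| r.
    rewrite mem_set//= mulr1; apply: ler_pM => //; exact: dquot_bound.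
  rewrite memNset/= ?mulr0; last by rewrite /= leNgt rx.
  have fx0 : f x = 0 by apply: f0; rewrite (le_lt_trans _ rx)// lerDl.
  rewrite {2}/dquot fx0 f0 ?subrr ?mulr0 ?normr0 ?mulr0//.
  have h1 : `|- (@harmonic R n) *: b| <= `|b|.
    rewrite normrZ normrN ger0_norm ?harmonic_ge0// ler_piMl//.
    by rewrite /harmonic invf_le1// ler1n.
  have := ler_normB (x + - harmonic n *: b) (- (@harmonic R n) *: b); rewrite addrK => xe.
  by rewrite -(ltrD2r `|b|); apply: lt_le_trans rx (le_trans xe _); rewrite lerD2l.
by have [_ _] := dominated_convergence measurableT mfn mf cvgf iG fG.
Qed.

(** The weak form of the equality of mixed derivatives: the identity is exact for
    difference quotients and passes to the limit. It is what
    makes the distributional curl of a gradient vanish. *)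
Lemma integral_derive_swap w f a b (Lw Lf M : R) :
  lipschitz_with Lw w -> lipschitz_with Lf f -> (forall x, M < `|x| -> f x = 0) ->
  {ae leb, forall x, derivable w x a} -> {ae leb, forall x, derivable w x b} ->
  (forall x, derivable f x a) -> (forall x, derivable f x b) ->
  \int[leb]_x ('D_a w x * 'D_b f x) = \int[leb]_x ('D_b w x * 'D_a f x).
Proof.
move=> wL fL f0 wa wb fa fb.
suff E : (\int[leb]_x ('D_a w x * 'D_b f x)%:E)%E =
         (\int[leb]_x ('D_b w x * 'D_a f x)%:E)%E by rewrite /Rintegral E.
have cw := lipschitz_with_continuous wL; have cf := lipschitz_with_continuous fL.
have En : (fun n => \int[leb]_x (dquot w a (harmonic n) x * dquot f b (- harmonic n) x)%:E)%E =
         (fun n => \int[leb]_x (dquot w b (harmonic n) x * dquot f a (- harmonic n) x)%:E)%E.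
  apply/funext => n.
  rewrite -[LHS]fineK; last first.
    by apply: integrable_fin_num => //; exact: (dquot_prod_integrable _ _ _ _ cw cf f0).
  rewrite -[RHS]fineK; last first.
    by apply: integrable_fin_num => //; exact: (dquot_prod_integrable _ _ _ _ cw cf f0).
  congr EFin; exact: (integral_dquot_swap _ _ _ cw cf f0).
have h1 := integral_dquot_cvg wL fL f0 wa fb.
have h2 := integral_dquot_cvg wL fL f0 wb fa.
rewrite En in h1.
exact: (cvg_unique (@ereal_hausdorff R) h1 h2).
Qed.

End difference_quotient.

(** * Piecewise continuously differentiable functions *)

Lemma is_derive_line (R : realType) (V W : normedModType R) (f : V -> W) (x v : V) (t : R) :
  derivable f (x + t *: v) v ->
  is_derive t 1 (fun s : R => f (x + s *: v)) ('D_v f (x + t *: v)).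
Proof.
move=> df; set g := fun s : R => f (x + s *: v).
have E : (fun h : R => h^-1 *: ((g \o shift t) (h *: (1 : R)) - g t)) =
         (fun h : R => h^-1 *: ((f \o shift (x + t *: v)) (h *: v) - f (x + t *: v))).
  apply/funext => h /=; rewrite /g; congr (_ *: (f _ - _)).
  by rewrite -[h *: 1]/(h * 1) mulr1 scalerDl addrCA addrA.
by apply: DeriveDef; rewrite /derivable /derive E.
Qed.

(** Fix [e > 0] and let [S] be the set of points up to which the increment of [phi]
    has slope at most [C + e]. The hypothesis at [sup S], used to its left, puts
    [sup S] into [S] and, used to its right, excludes [sup S < 1]. *)
Lemma lipschitz_along_segment (R : realType) (phi : R -> R) (C : R) :
  (forall (t e : R), 0 < e -> \forall s \near t, `|phi s - phi t| <= (C + e) * `|s - t|) ->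
  `|phi 1 - phi 0| <= C.
Proof.
move=> H; apply/ler_addgt0Pr => e e0; set K := C + e.
pose S := [set t : R | 0 <= t <= 1 /\ `|phi t - phi 0| <= K * t].
have S0 : S 0 by split; rewrite ?lexx ?ler01// subrr normr0 mulr0.
have hS : has_sup S by split; [exists 0|exists 1 => t [/andP[]]].
have S01 : 0 <= sup S <= 1.
  apply/andP; split; first by apply: ub_le_sup => //; exact: hS.2.
  by apply: ge_sup; [exists 0|move=> t [/andP[]]].
have [d /= d0 Hd] := H (sup S) e e0.
have SS : `|phi (sup S) - phi 0| <= K * sup S.
  have [s Ss sd] := sup_adherent d0 hS.
  have sS : s <= sup S by apply: ub_le_sup => //; exact: hS.2.
  have /Hd : ball_ (fun x => `|x|) (sup S) d s by rewrite /= ger0_norm ?subr_ge0//; lra.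
  rewrite /= -/K [in `|s - _|]distrC (ger0_norm (x := sup S - s)) ?subr_ge0// => h1.
  have h2 := Ss.2.
  rewrite (_ : _ - _ = (phi (sup S) - phi s) + (phi s - phi 0)); last by ring.
  apply: le_trans (ler_normD _ _) _; rewrite distrC.
  by apply: le_trans (lerD h1 h2) _; rewrite mulrBr subrK.
have [S1|S1] := eqVneq (sup S) 1; first by rewrite S1 mulr1 in SS.
have {}S1 : sup S < 1 by case/andP: S01 => _ h; rewrite lt_neqAle S1.
pose s := Num.min 1 (sup S + d / 2).
have Ss : sup S < s by rewrite lt_min S1 /= ltrDl divr_gt0.
have sd : s - sup S < d.
  have : s <= sup S + d / 2 by rewrite /s ge_min lexx orbT.
  lra.
suff : S s by move=> /(ub_le_sup hS.2); rewrite leNgt Ss.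
split; first by rewrite /s ge_min lexx /= andbT; case/andP: S01 => h _; exact: le_trans h (ltW Ss).
have /Hd : ball_ (fun x => `|x|) (sup S) d s.
  by rewrite /= distrC ger0_norm ?subr_ge0// ltW.
rewrite /= -/K (ger0_norm (x := s - sup S)) ?subr_ge0; last exact: ltW.
move=> h1.
rewrite (_ : _ - _ = (phi s - phi (sup S)) + (phi (sup S) - phi 0)); last by ring.
apply: le_trans (ler_normD _ _) _.
by apply: le_trans (lerD h1 SS) _; rewrite mulrBr subrK.
Qed.

Section null_sets.
Context {R : realType} {d : nat}.
Local Notation leb := (lebesgue_rV R d).
Implicit Types (A : set 'rV[R]_d) (f g w : 'rV[R]_d -> R) (v : 'rV[R]_d).

(** The sets [A - v/(n+1)] are pairwise disjoint, lie in one bounded set and all have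
    the measure of [A]; a bounded set has no room for infinitely many of them unless
    this measure is zero. *)
Lemma null_of_disjoint_translates A v : measurable A -> bounded_set A ->
  (forall x s, A x -> A (x + s *: v) -> s = 0) -> leb A = 0%E.
Proof.
move=> mA [r [_ Ar]] Av.
pose F n := (fun x => x + (@harmonic R n) *: v) @^-1` A.
have mF n : measurable (F n).
  by rewrite -[X in measurable X]setTI; exact: measurable_shift.
have tF : trivIset setT F.
  apply/trivIsetP => m n _ _ mn; rewrite -subset0 => x [/= Axm Axn].
  have := Av (x + harmonic m *: v) (harmonic n - harmonic m) Axm.
  rewrite -addrA -scalerDl [X in X *: v]addrC subrK => /(_ Axn) /eqP.
  rewrite subr_eq0 /harmonic => /eqP /invr_inj /eqP.
  by rewrite eqr_nat eqSS eq_sym (negbTE mn).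
pose B := [set x : 'rV[R]_d | `|x| <= `|r| + 1 + `|v|].
have mB : measurable B := measurable_norm_le _.
have Bfin : (leb B < +oo)%E.
  apply: lebesgue_rV_bounded_lty => //.
  exists (`|r| + 1 + `|v|); split; first exact: num_real.
  by move=> M rM x /= /le_trans; apply; exact: ltW.
have FB : \bigcup_n F n `<=` B.
  move=> x [n _ /= Axn]; rewrite /B /=.
  have h1 : `|(@harmonic R n) *: v| <= `|v|.
    rewrite normrZ ger0_norm ?harmonic_ge0// ler_piMl//.
    by rewrite /harmonic invf_le1// ler1n.
  have h2 : `|x + (@harmonic R n) *: v| <= `|r| + 1.
    by apply: Ar => //; rewrite ltr_pwDr// ler_norm.
  have := ler_normB (x + harmonic n *: v) ((@harmonic R n) *: v); rewrite addrK => h3.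
  by apply: le_trans h3 _; exact: lerD.
have Fle : (\sum_(0 <= i <oo) leb A <= leb B)%E.
  rewrite (_ : (\sum_(0 <= i <oo) leb A)%E = leb (\bigcup_n F n)).
    by apply: le_measure; rewrite ?inE//; exact: bigcupT_measurable.
  rewrite measure_bigcup// [RHS]eseries_mkcond; apply: eq_eseriesr => n _.
  by rewrite mem_set//; exact/esym/lebesgue_rV_shift.
have Alt : (leb A < +oo)%E.
  apply: le_lt_trans Bfin; apply: le_trans Fle.
  apply: le_trans (nneseries_lim_ge 1 _) => [|n _ _]; last exact: measure_ge0.
  by rewrite big_nat1.
have Afin : leb A \is a fin_num by rewrite ge0_fin_numE//; exact: measure_ge0.
have Bf : leb B \is a fin_num by rewrite ge0_fin_numE//; exact: measure_ge0.
apply/eqP; rewrite eq_le measure_ge0 andbT -(fineK Afin) lee_fin leNgt; apply/negP => a0.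
have nle n : (n%:R * fine (leb A) <= fine (leb B)).
  rewrite -lee_fin (fineK Bf); apply: le_trans Fle.
  apply: le_trans (nneseries_lim_ge n _) => [|k _ _]; last exact: measure_ge0.
  under eq_bigr do rewrite -(fineK Afin).
  by rewrite sumEFin sumr_const_nat subn0 mulr_natl.
have := nle (Num.truncn (fine (leb B) / fine (leb A))).+1.
rewrite -ler_pdivlMr// leNgt truncnS_gt//.
Qed.

(** The rational boxes form a countable basis, so the local null sets can be chosen
    among countably many. *)
Lemma negligible_locally A :
  (forall x, A x -> exists2 U, nbhs x U & leb.-negligible (A `&` U)) ->
  leb.-negligible A.
Proof.
move=> H; pose F n := if unpickle n is Some p then
  (if `[< leb.-negligible (A `&` @rat_box R d p) >] then A `&` @rat_box R d p else set0) else set0.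
apply: (@negligibleS _ _ _ _ (\bigcup_n F n)); last first.
  apply: negligible_bigcup => n; rewrite /F.
  case: unpickle => [p|]; last exact: negligible_set0.
  by case: asboolP => // _; exact: negligible_set0.
move=> x Ax; have [U xU nU] := H x Ax; have [p xp pU] := rat_box_nbhs xU.
exists (pickle p) => //; rewrite /F pickleK asboolT//.
by apply: negligibleS nU; exact: setIS.
Qed.

(** Near such a point the derivative along [v] keeps away from zero, so by the mean
    value theorem a line in direction [v] meets the zero set at most once there. The
    translates of the zero set along [v] are then disjoint. *)
Lemma negligible_transversal_zeros (V : set 'rV[R]_d) g v : open V ->
  (forall x, V x -> differentiable g x /\ {for x, continuous ('D_v g)}) ->
  leb.-negligible [set x | [/\ V x, g x = 0 & 'D_v g x != 0]].
Proof.
move=> oV gV; set Z := mkset _.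
have cg : {in V, continuous g}.
  by move=> x /set_mem Vx; apply: differentiable_continuous; exact: (gV x Vx).1.
have cDg : {in V, continuous ('D_v g)} by move=> x /set_mem Vx; exact: (gV x Vx).2.
have mV := open_measurable_rV oV.
have mZ : measurable Z.
  rewrite (_ : Z = (V `&` g @^-1` [set 0]) `&` (V `&` 'D_v g @^-1` (~` [set 0]))).
    apply: measurableI.
      exact: (continuous_on_open_measurable oV cg mV (measurable_set1 0)).
    exact: (continuous_on_open_measurable oV cDg mV (measurableC (measurable_set1 0))).
  by apply/seteqP; split => x /=; [move=> [? ? /eqP ?]|move=> [[? ?] [_ /eqP ?]]].
apply: negligible_locally => x0 [Vx0 gx0 Dx0].
have : \forall y \near x0, V y /\ 'D_v g y != 0.
  apply: filterI; first exact: open_nbhs_nbhs.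
  have H := cDg _ (mem_set Vx0).
  exact: (@cvgr_neq0 _ R^o _ (nbhs x0) _ ('D_v g) ('D_v g x0) H Dx0).
move=> /nbhs_ballP [e /= e0 He]; exists (ball x0 e); first exact: nbhsx_ballx.
exists (Z `&` ball x0 e); split => //.
  by apply: measurableI => //; apply: open_measurable_rV; exact: ball_open.
apply: (@null_of_disjoint_translates _ v).
- by apply: measurableI => //; apply: open_measurable_rV; exact: ball_open.
- exists (`|x0| + e); split; first exact: num_real.
  move=> M rM x [_]; rewrite mx_norm_ball /ball_ /= => xe.
  have := ler_normB x0 (x0 - x); rewrite subKr; move: xe rM; lra.
have main x s : (Z `&` ball x0 e) x -> (Z `&` ball x0 e) (x + s *: v) -> 0 < s -> False.
  move=> [[Vx gx Dx] xe] [[Vy gy Dy] ye] s0.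
  have Bt t : t \in `[0, s] -> ball x0 e (x + t *: v).
    rewrite in_itv/= => /andP[t0 ts]; move: xe ye; rewrite mx_norm_ball /ball_ /= => xe ye.
    have -> : x0 - (x + t *: v) = (1 - t / s) *: (x0 - x) + (t / s) *: (x0 - (x + s *: v)).
      by apply/rowP => j; rewrite !mxE; field; rewrite gt_eqF.
    have ts0 : 0 <= t / s by rewrite divr_ge0// ltW.
    have ts1 : t / s <= 1 by rewrite ler_pdivrMr// mul1r.
    apply: le_lt_trans (ler_normD _ _) _; rewrite (normrZ (1 - t / s)) (normrZ (t / s))
      (ger0_norm ts0) (ger0_norm (x := 1 - t / s)) ?subr_ge0//.
    have [->|ts'] := eqVneq (t / s) 0; first by rewrite subr0 mul1r mul0r addr0.
    have {}ts0 : 0 < t / s by rewrite lt_neqAle eq_sym ts'.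
    have : (1 - t / s) * `|x0 - x| <= (1 - t / s) * e by rewrite ler_wpM2l ?subr_ge0// ltW.
    have : t / s * `|x0 - (x + s *: v)| < t / s * e by rewrite ltr_pM2l.
    by rewrite mulrBl mul1r; lra.
  have Dt (u : R) : u \in `[0, s] ->
      is_derive u (1 : R) (fun t : R => g (x + t *: v)) ('D_v g (x + u *: v)).
    move=> /Bt/He[Vt _]; apply: is_derive_line; apply: diff_derivable.
    exact: (gV _ Vt).1.
  pose G (t : R) : R := g (x + t *: v); pose G' (t : R) : R := 'D_v g (x + t *: v).
  have GE : G s = G 0 by rewrite /G gy scale0r addr0 gx.
  have dG (t : R) : t \in `]0, s[ -> is_derive t 1 G (G' t).
    by move=> ts; apply: Dt; exact: subset_itv_oo_cc ts.
  have cG : {within `[0, s], continuous G}.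
    apply: derivable_within_continuous => t ts.
    by have [] := Dt t ts.
  have [c cs] := MVT_segment (ltW s0) dG cG.
  rewrite GE subrr subr0 => /esym/eqP; rewrite mulf_eq0 (gt_eqF s0) orbF.
  by have /He[_ /negPf ->] := Bt c cs.
move=> x s Ax Ay; have [s0|s0|//] := ltgtP s 0.
  exfalso; apply: (main (x + s *: v) (- s)) => //; last by rewrite oppr_gt0.
  by rewrite scaleNr addrK.
by exfalso; exact: (main x s).
Qed.

End null_sets.

Section piecewise_C1.
Context {R : realType} {d : nat} {I : finType}.
Local Notation leb := (lebesgue_rV R d).
Variables (C V : I -> set 'rV[R]_d) (q : I -> 'rV[R]_d -> R) (w : 'rV[R]_d -> R).
Hypothesis closedC : forall i, closed (C i).
Hypothesis coverC : forall x, exists i, C i x.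
Hypothesis openV : forall i, open (V i).
Hypothesis CV : forall i, C i `<=` V i.
Hypothesis qC1 : forall i x, V i x ->
  differentiable (q i) x /\ forall v, {for x, continuous ('D_v (q i))}.
Hypothesis wq : forall i x, C i x -> w x = q i x.

(** Near [x] only the pieces that contain [x] matter, because the others are closed
    and finite in number; on each of them the increments of [w] are those of the
    differentiable function [q i]. *)
Let near_piece (x v : 'rV[R]_d) (l : I -> R) (e : R) : 0 < e ->
  (forall i, C i x -> l i = 'D_v (q i) x) ->
  \forall h \near (0 : R)^', exists2 i, C i x & `|dquot w v h x - l i| < e.
Proof.
move=> e0 lE.
have H i : \forall h \near (0 : R)^', C i (x + h *: v) ->
    C i x /\ `|dquot w v h x - l i| < e.
  have [Cx|nCx] := pselect (C i x).
    have dq : derivable (q i) x v by apply: diff_derivable; exact: (qC1 (CV Cx)).1.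
    have /cvgrPdist_lt/(_ _ e0) := derivable_dquot dq.
    apply: filterS => h qh Ch; split => //; rewrite lE// distrC.
    by rewrite /dquot (wq Ch) (wq Cx).
  have : \forall y \near x, ~ C i y.
    by apply: open_nbhs_nbhs; split => //; exact: closed_openC.
  have cx : (fun h : R => x + h *: v) h @[h --> (0 : R)^'] --> x.
    have : (fun h : R => x + h *: v) h @[h --> (0 : R)^'] --> x + 0 *: v.
      by apply: cvgD; [exact: cvg_cst|apply: cvgZr_tmp; exact: cvg_within].
    by rewrite scale0r addr0.
  move=> nCy.
  apply: (@filterS _ (0 : R)^' _ (fun h : R => ~ C i (x + h *: v))) => [h nC /nC //|].
  exact: cx nCy.
have FF : Filter (0 : R)^' by exact: dnbhs_filter.
apply: (@filterS R (0 : R)^' FF _ _ _ (filter_forall FF H)) => h Hh.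
by have [i Ci] := coverC (x + h *: v); have [Cx ?] := Hh i Ci; exists i.
Qed.

(** A segment may cross from one piece to another infinitely often, so the bound
    cannot be summed piece by piece; it is obtained from the pointwise slopes through
    [lipschitz_along_segment]. *)
Lemma piecewise_C1_lipschitz (L : R) : 0 <= L ->
  (forall i x v, C i x -> `|'D_v (q i) x| <= L * `|v|) -> lipschitz_with L w.
Proof.
move=> L0 qL; split => // y x; pose u := y - x.
suff : `|w (x + 1 *: u) - w (x + 0 *: u)| <= L * `|u|.
  by rewrite scale1r scale0r addr0 /u [x + _]addrC subrK.
apply: (@lipschitz_along_segment _ (fun t => w (x + t *: u))) => t e e0.
pose z := x + t *: u.
have := @near_piece z u (fun i => 'D_u (q i) z) e e0 (fun _ _ => erefl).
move=> [r /= r0 Hr]; exists r => //= s ts.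
have [->|st] := eqVneq s t.
  by rewrite !subrr normr0 mulr0.
have [||i Cz] := Hr (s - t).
- by rewrite /= sub0r opprB.
- by rewrite subr_eq0.
rewrite /dquot /z -addrA -scalerDl [t + _]addrC subrK => H.
have D := qL i _ u Cz.
have st0 : 0 < `|s - t| by rewrite normr_gt0 subr_eq0.
rewrite -ler_pdivrMr// mulrC -normfV -normrM.
set A := (s - t)^-1 * _ in H *.
rewrite (_ : A = (A - 'D_u (q i) z) + 'D_u (q i) z); last by rewrite subrK.
by apply: le_trans (ler_normD _ _) _; rewrite addrC lerD// ltW.
Qed.

(** If all pieces through [x] have the same derivative along [v], this is the
    derivative of [w]. Otherwise [x] is a zero of some [q i - q j] at which the
    derivative of this difference does not vanish, and such zeros form a null set. *)
Lemma piecewise_C1_derivable_ae (v : 'rV[R]_d) : {ae leb, forall x, derivable w x v}.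
Proof.
pose Z i j := [set x | [/\ (V i `&` V j) x, (q i - q j) x = 0 & 'D_v (q i - q j) x != 0]].
have nZ i j : leb.-negligible (Z i j).
  apply: negligible_transversal_zeros; first exact: openI.
  move=> x [Vi Vj]; split.
    by apply: differentiableB; [exact: (qC1 Vi).1|exact: (qC1 Vj).1].
  have E : \forall y \near x, 'D_v (q i) y - 'D_v (q j) y = 'D_v (q i - q j) y.
    have : \forall y \near x, (V i `&` V j) y.
      by apply: open_nbhs_nbhs; split => //; exact: openI.
    apply: filterS => y [Viy Vjy]; rewrite deriveB//; apply: diff_derivable.
      exact: (qC1 Viy).1.
    exact: (qC1 Vjy).1.
  have Ex : 'D_v (q i) x - 'D_v (q j) x = 'D_v (q i - q j) x := nbhs_singleton E.
  suff : 'D_v (q i) y - 'D_v (q j) y @[y --> x] --> 'D_v (q i) x - 'D_v (q j) x.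
    by rewrite Ex => H; apply: cvg_trans H; exact: near_eq_cvg E.
  by apply: (@continuousB _ R^o 'rV[R]_d ('D_v (q i)) ('D_v (q j))); [exact: (qC1 Vi).2|exact: (qC1 Vj).2].
have : leb.-negligible (\big[setU/set0]_(p : I * I) Z p.1 p.2).
  by apply: big_ind => //; [exact: negligible_set0|move=> *; exact: negligibleU].
apply: negligibleS => x /= nd; apply: contrapT => nZx; apply: nd.
have [i0 C0] := coverC x.
have lE i : C i x -> 'D_v (q i0) x = 'D_v (q i) x.
  move=> Ci; apply/eqP; apply: contrapT => /negP nE; apply: nZx.
  rewrite -bigcup_seq; exists (i0, i); first exact: mem_index_enum.
  split => /=; first by split; exact: CV.
    by change (q i0 x - q i x = 0); rewrite -(wq Ci) -(wq C0) subrr.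
  by rewrite deriveB ?subr_eq0//; apply: diff_derivable; [exact: (qC1 (CV C0)).1|exact: (qC1 (CV Ci)).1].
suff : dquot w v h x @[h --> 0^'] --> 'D_v (q i0) x by case/dquot_derive.
apply/cvgrPdist_lt => e e0; have := near_piece e0 lE.
by apply: filterS => h [i _]; rewrite distrC.
Qed.

End piecewise_C1.

(** * Polynomials and barycentric coordinates *)

Section directional_derivatives.
Context {R : realType} {d : nat}.
Implicit Types (p q : 'rV[R]_d -> R) (x y z u v : 'rV[R]_d).

Lemma derive_sum_coord p z u : differentiable p z ->
  'D_u p z = \sum_j u 0 j * 'D_(delta_mx 0 j) p z.
Proof.
move=> dp; rewrite deriveE// {1}[u]row_sum_delta linear_sum.
by apply: eq_bigr => j _; rewrite linearZ deriveE.
Qed.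

Lemma derive_comp (V W U : normedModType R) (g : V -> W) (f : W -> U) (y v : V) :
  differentiable g y -> differentiable f (g y) ->
  'D_v (f \o g) y = 'D_('D_v g y) f (g y).
Proof.
move=> dg df; rewrite !deriveE//; last exact: differentiable_comp.
by rewrite diff_comp.
Qed.

End directional_derivatives.

Section polynomials.
Context {R : realType} {d : nat}.
Implicit Types (p q : 'rV[R]_d -> R) (x : 'rV[R]_d) (e : 'I_d -> nat) (k : nat).

Definition monomial e x : R := \prod_i x 0 i ^+ e i.

Lemma poly_fun_monomial k e : (\sum_i e i <= k)%N -> poly_fun k (monomial e).
Proof.
move=> ek; have eik i : (e i < k.+1)%N.
  by rewrite ltnS (leq_trans _ ek)// (bigD1 i)//= leq_addr.
pose a : {ffun 'I_d -> 'I_k.+1} := [ffun i => inord (e i)].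
have aE i : a i = e i :> nat by rewrite ffunE inordK.
exists (fun b => (b == a)%:R) => x.
rewrite (bigD1 a)/=; last by under eq_bigr do rewrite aE.
rewrite eqxx mul1r [X in _ + X]big1 ?addr0; last first.
  by move=> b; case/andP => _ /negPf ->; rewrite mul0r.
by apply: eq_bigr => i _; rewrite aE.
Qed.

Lemma poly_fun_lin k p q (s t : R) : poly_fun k p -> poly_fun k q ->
  poly_fun k (fun x => s * p x + t * q x).
Proof.
move=> [c pE] [c' qE]; exists (fun a => s * c a + t * c' a) => x.
rewrite pE qE !mulr_sumr -big_split/=; apply: eq_bigr => a _.
by rewrite mulrDl !mulrA.
Qed.

Lemma poly_fun0 k : poly_fun k (fun _ : 'rV[R]_d => 0 : R).
Proof. by exists (fun=> 0) => x; rewrite big1// => a _; rewrite mul0r. Qed.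

Lemma poly_funP k p : poly_fun k p ->
  exists c : {ffun 'I_d -> 'I_k.+1} -> R,
  p = \sum_(a : {ffun 'I_d -> 'I_k.+1} | (\sum_i a i <= k)%N)
        (fun x => c a * monomial (fun i => a i) x).
Proof.
by move=> [c pE]; exists c; apply/funext => x; rewrite pE fct_sumE.
Qed.

Lemma monomial_delta e j x : monomial e x =
  x 0 j ^+ e j * \prod_(i | i != j) x 0 i ^+ e i.
Proof. by rewrite /monomial (bigD1 j). Qed.

Lemma derive_coord j x v : 'D_v (fun x : 'rV[R]_d => x 0 j) x = v 0 j.
Proof.
have /dquot_derive[] : dquot (fun x : 'rV[R]_d => x 0 j) v h x @[h --> 0^'] --> v 0 j; last by [].
apply: cvg_near_cst.
have : \forall h \near (0 : R)^', h != 0 by exact: nbhs_dnbhs_neq.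
apply: filterS => h h0; apply/eqP; rewrite /dquot !mxE [_ + h * _]addrC addrK mulKf//.
Qed.

Lemma differentiable_prod (I : Type) (r : seq I) (P : pred I) (F : I -> 'rV[R]_d -> R) x :
  (forall i, differentiable (F i) x) -> differentiable (fun y => \prod_(i <- r | P i) F i y) x.
Proof.
move=> dF; elim: r => [|i r IH].
  by under eq_fun do rewrite big_nil; exact: differentiable_cst.
under eq_fun do rewrite big_cons; case: (P i) => //.
exact: differentiableM.
Qed.

Lemma differentiable_coordX j n x : differentiable (fun y : 'rV[R]_d => y 0 j ^+ n) x.
Proof.
have -> : (fun y : 'rV[R]_d => y 0 j ^+ n) = (fun y : 'rV[R]_d => y 0 j) ^+ n.
  by rewrite exprfctE.
case: n => [|n]; first by rewrite expr0; exact: differentiable_cst.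
by apply: differentiableX; exact: differentiable_coord.
Qed.

Lemma derive_monomial e j x : 'D_(delta_mx 0 j) (monomial e) x =
  (e j)%:R * monomial (fun i => if i == j then (e i).-1 else e i) x.
Proof.
pose c := fun y : 'rV[R]_d => \prod_(i | i != j) y 0 i ^+ e i.
have dc : differentiable c x by apply: differentiable_prod => i; exact: differentiable_coordX.
have Dc : 'D_(delta_mx 0 j) c x = 0.
  have /dquot_derive[] : dquot c (delta_mx 0 j) h x @[h --> 0^'] --> (0 : R); last by [].
  apply: cvg_near_cst; apply: nearW => h; apply/eqP; rewrite /dquot (_ : c _ = c x) ?subrr ?mulr0//.
  by apply: eq_bigr => i ij; rewrite !mxE eqxx /= (negPf ij) mulr0 addr0.
pose f : 'rV[R]_d -> R := fun y => y 0 j.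
have df : derivable f x (delta_mx 0 j).
  by apply: diff_derivable; exact: differentiable_coord.
have -> : monomial e = (f ^+ e j) * c.
  by rewrite exprfctE; apply/funext => y; exact: monomial_delta.
rewrite deriveM; [|exact: derivableX|exact: diff_derivable].
rewrite Dc scaler0 add0r deriveX// derive_coord mxE !eqxx/= (monomial_delta _ j) eqxx.
rewrite [RHS]mulrA [RHS]mulrC /GRing.scale/= mulr1; congr (_ * _).
by apply: eq_bigr => i /negPf ->.
Qed.

(** The predicate [poly_fun] is stated with coefficient families over multi-indices;
    the derivative is computed on each monomial, where it lowers one exponent. *)
Lemma poly_fun_diff k p : poly_fun k p ->
  (forall x, differentiable p x) /\ forall j, poly_fun k.-1 ('D_(delta_mx 0 j) p).
Proof.
move=> /poly_funP[c ->].
set G := fun p => (forall x, differentiable p x) /\ forall j, poly_fun k.-1 ('D_(delta_mx 0 j) p).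
rewrite -/(G _); apply: (big_ind G).
- split; first by move=> x; exact: differentiable_cst.
  by move=> j; rewrite (_ : 'D__ _ = fun=> 0); [exact: poly_fun0|apply/funext => x; exact: derive_cst].
- move=> p1 p2 [d1 D1] [d2 D2]; split; first by move=> x; exact: differentiableD.
  move=> j; rewrite (_ : 'D__ _ = (fun x => 1 * 'D_(delta_mx 0 j) p1 x + 1 * 'D_(delta_mx 0 j) p2 x)).
    exact: poly_fun_lin.
  by apply/funext => x; rewrite deriveD ?mul1r//; exact: diff_derivable.
- move=> a ak; pose e := fun i => a i : nat.
  have dm x : differentiable (monomial e) x.
    by apply: differentiable_prod => i; exact: differentiable_coordX.
  have -> : (fun x => c a * monomial e x) = c a *: monomial e by [].
  split; first by move=> x; exact: differentiableZ.
  move=> j; pose e' := (fun i => if i == j then (e i).-1 else e i).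
  have -> : 'D_(delta_mx 0 j) (c a *: monomial e) =
     (fun x => c a * ((e j)%:R * monomial e' x)).
    by apply/funext => x; rewrite deriveZ ?derive_monomial//; exact: diff_derivable.
  have [ej0|ej0] := posnP (e j).
    by rewrite ej0; under eq_fun do rewrite mul0r mulr0; exact: poly_fun0.
  have e'k : (\sum_i e' i <= k.-1)%N.
    rewrite -ltnS prednK; last first.
      by apply: leq_trans ej0 _; apply: leq_trans ak; rewrite (bigD1 j)//= leq_addr.
    apply: leq_trans ak; rewrite [ltnRHS](bigD1 j)//= (bigD1 j)//= /e' eqxx -addSn prednK// leq_add2l.
    by apply: leq_sum => i /negPf ->.
  have := poly_fun_lin (c a * (e j)%:R) 0 (poly_fun_monomial e'k) (poly_fun0 k.-1).
  by under eq_fun do rewrite mulr0 addr0 -mulrA.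
Qed.

Lemma poly_fun_continuous k p : poly_fun k p -> continuous p.
Proof. by move=> /poly_fun_diff[dp _] x; exact: differentiable_continuous. Qed.

End polynomials.

Section simplex.
Context {R : realType} {d : nat}.
Implicit Types (x : 'rV[R]_d) (p : 'rV[R]_d -> R).

Lemma bary0 x : bary x ord0 = 1 - \sum_j x 0 j.
Proof. by rewrite /bary unlift_none. Qed.

Lemma bary_lift x j : bary x (lift ord0 j) = x 0 j.
Proof. by rewrite /bary liftK. Qed.

Lemma sum_bary x : \sum_a bary x a = 1.
Proof.
rewrite big_ord_recl bary0.
rewrite [X in _ + X](_ : _ = \sum_j x 0 j) ?subrK//.
by apply: eq_bigr => j _; exact: bary_lift.
Qed.

Lemma coord_Kvertex (a : 'I_d.+1) j : Kvertex (R := R) a 0 j = (a == lift ord0 j)%:R.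
Proof. by rewrite mxE. Qed.

Lemma sum_bary_vertex x j : \sum_a bary x a * Kvertex a 0 j = x 0 j.
Proof.
rewrite (bigD1 (lift ord0 j))//= coord_Kvertex eqxx mulr1 bary_lift big1 ?addr0// => a aj.
by rewrite coord_Kvertex (negPf aj) mulr0.
Qed.

Lemma bary_Kvertex (a b : 'I_d.+1) : bary (Kvertex (R := R) a) b = (a == b)%:R.
Proof.
case: (unliftP ord0 b) => [j ->|->]; first by rewrite bary_lift coord_Kvertex.
rewrite bary0; case: (unliftP ord0 a) => [i ->|->].
  rewrite (bigD1 i)//= coord_Kvertex eqxx big1 ?addr0 ?subrr//.
  by move=> j ji; rewrite coord_Kvertex (inj_eq lift_inj) eq_sym (negPf ji).
rewrite big1 ?subr0// => j _; rewrite coord_Kvertex.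
by rewrite (negPf (neq_lift _ _)).
Qed.

Lemma Khat_Kvertex a : Khat (R := R) (Kvertex a : 'rV[R]_d).
Proof. by move=> b; rewrite bary_Kvertex ler0n. Qed.

(** Both sides are linear in [p], so it is enough to compare them on 1 and on the
    coordinates. *)
Lemma affine_bary p : poly_fun 1 p -> forall x, p x = \sum_a bary x a * p (Kvertex a).
Proof.
move=> /poly_funP[c ->].
set G := fun p : 'rV[R]_d -> R => forall x, p x = \sum_a bary x a * p (Kvertex a).
rewrite -/(G _); apply: (big_ind G).
- by move=> x; rewrite big1// => a _; rewrite mulr0.
- move=> p1 p2 h1 h2 x; rewrite addrfctE h1 h2 -big_split/=.
  by apply: eq_bigr => a _; rewrite -mulrDr.
- move=> a ak x.
  suff -> : monomial (fun i => a i) x = \sum_b bary x b * monomial (fun i => a i) (Kvertex b).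
    by rewrite mulr_sumr; apply: eq_bigr => b _; rewrite mulrCA.
  have [/existsP[j aj]|/existsPn a0] := boolP [exists j, (0 < a j)%N].
    have aj1 : a j = 1%N :> nat.
      apply/eqP; rewrite eqn_leq aj andbT; apply: leq_trans ak.
      by rewrite (bigD1 j)//= leq_addr.
    have ai i : i != j -> a i = 0%N :> nat.
      move=> ij; move: ak; rewrite (bigD1 j)//= aj1 (bigD1 i)//=.
      by rewrite add1n ltnS leqn0 addn_eq0 => /andP[/eqP].
    have mE y : monomial (R := R) (fun i => a i) y = y 0 j.
      rewrite (monomial_delta _ j) aj1 expr1 big1 ?mulr1// => i ij.
      by rewrite ai// expr0.
    rewrite mE -[LHS]sum_bary_vertex; apply: eq_bigr => b _; by rewrite mE.
  have mE y : monomial (R := R) (fun i => a i) y = 1.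
    by rewrite /monomial big1// => i _; have := a0 i; rewrite lt0n negbK => /eqP ->; rewrite expr0.
  by rewrite mE -[LHS](sum_bary x); apply: eq_bigr => b _; rewrite mE mulr1.
Qed.

Lemma Khat_coord x j : Khat x -> 0 <= x 0 j <= 1.
Proof.
move=> Kx; have x0 i : 0 <= x 0 i by rewrite -bary_lift; exact: Kx.
rewrite x0/=; have := Kx ord0; rewrite bary0 subr_ge0; apply: le_trans.
by rewrite (bigD1 j)//= lerDl sumr_ge0.
Qed.

Lemma bary_continuous a : continuous (fun x : 'rV[R]_d => bary x a).
Proof.
case: (unliftP ord0 a) => [j ->|->].
  by under eq_fun do rewrite bary_lift; exact: coord_continuous.
under eq_fun do rewrite bary0; apply: cts_sub; first exact: cst_continuous.
move=> x; apply: (@differentiable_continuous _ _ R^o).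
have -> : (fun x : 'rV[R]_d => \sum_j x 0 j) = \sum_j (fun x : 'rV[R]_d => x 0 j).
  by apply/funext => y; rewrite fct_sumE.
by apply: differentiable_sum => j; exact: differentiable_coord.
Qed.

Lemma Khat_compact : compact (Khat (R := R) (d := d)).
Proof.
apply: bounded_closed_compact.
  exists 1; split; first exact: num_real.
  move=> M M1 x /Khat_coord Kx; apply: le_trans (ltW M1).
  apply: norm_rV_le => // i; have /andP[x0 x1] := Kx i.
  by rewrite ger0_norm.
rewrite (_ : Khat = \bigcap_a [set x | 0 <= bary x a]).
  apply: closed_bigI => a _.
  apply: (closed_comp _ (@closed_ge R 0)) => x _; exact: bary_continuous.
by apply/seteqP; split => x /= H a => [_|]; [exact: H|exact: (H a I)].
Qed.

End simplex.

(** * Square integrable fields *)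

Section square_integrable.
Context {R : realType} {d : nat} (Omega : set 'rV[R]_d).
Hypothesis mOmega : measurable Omega.
Local Notation leb := (lebesgue_rV R d).
Implicit Types F G H : 'rV[R]_d -> 'rV[R]_3.

(** From $|ab| \le a^2 + b^2$. *)
Lemma in_L2_mul F G k : in_L2 Omega F -> in_L2 Omega G ->
  leb.-integrable Omega (fun x => (F x 0 k * G x 0 k)%:E).
Proof.
move=> F2 G2; have [mF iF] := F2 k; have [mG iG] := G2 k.
have := integrableD mOmega iF iG; apply: le_integrable => //.
  by apply/measurable_EFinP; exact: measurable_funM.
move=> x _ /=; rewrite lee_fin [leRHS]ger0_norm; last by apply: addr_ge0; exact: sqr_ge0.
rewrite /component ler_norml; set a := F x 0 k; set b := G x 0 k.
apply/andP; split; nra.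
Qed.

Lemma dotE (u v : 'rV[R]_3) :
  dot u v = u 0 0 * v 0 0 + u 0 1 * v 0 1 + u 0 2%:R * v 0 2%:R.
Proof.
rewrite /dot !big_ord_recl big_ord0 addr0 addrA.
by congr (_ * _ + _ * _ + _ * _); congr (_ _ _); apply/val_inj.
Qed.

Lemma in_L2_dot F G : in_L2 Omega F -> in_L2 Omega G ->
  leb.-integrable Omega (fun x => (dot (F x) (G x))%:E).
Proof.
move=> F2 G2; under eq_fun do rewrite dotE !EFinD.
by apply: integrableD => //; [apply: integrableD => //|]; exact: in_L2_mul.
Qed.

Lemma in_L2_lin (s t : R) F G : in_L2 Omega F -> in_L2 Omega G ->
  in_L2 Omega (fun x => s *: F x + t *: G x).
Proof.
move=> F2 G2 k.
have E : component (fun x => s *: F x + t *: G x) k =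
    (fun x => s * F x 0 k + t * G x 0 k).
  by apply/funext => x; rewrite /component !mxE.
have [mF iF] := F2 k; have [mG iG] := G2 k; rewrite E; split.
  by apply: measurable_funD; apply: measurable_funM => //; exact: measurable_cst.
have -> : (fun x => ((s * F x 0 k + t * G x 0 k) ^+ 2)%:E) =
   (fun x => (s ^+ 2)%:E * (F x 0 k ^+ 2)%:E + (2 * s * t)%:E * (F x 0 k * G x 0 k)%:E
       + (t ^+ 2)%:E * (G x 0 k ^+ 2)%:E)%E.
  by apply/funext => x; rewrite -!EFinM -!EFinD; congr EFin; ring.
apply: integrableD => //; last exact: integrableZl.
by apply: integrableD => //; apply: integrableZl => //; exact: in_L2_mul.
Qed.

Lemma dotC n (u v : 'rV[R]_n) : dot u v = dot v u.
Proof. by apply: eq_bigr => i _; rewrite mulrC. Qed.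

Lemma ipL2C F G : ipL2 Omega F G = ipL2 Omega G F.
Proof. by apply: eq_Rintegral => x _; exact: dotC. Qed.

Lemma dot_lin n (s t : R) (u v w : 'rV[R]_n) :
  dot (s *: u + t *: v) w = s * dot u w + t * dot v w.
Proof.
rewrite /dot !mulr_sumr -big_split/=; apply: eq_bigr => i _.
by rewrite !mxE mulrDl !mulrA.
Qed.

Lemma ipL2_lin (s t : R) F G H : in_L2 Omega F -> in_L2 Omega G -> in_L2 Omega H ->
  ipL2 Omega (fun x => s *: F x + t *: G x) H = s * ipL2 Omega F H + t * ipL2 Omega G H.
Proof.
move=> F2 G2 H2; rewrite /ipL2.
have iF := in_L2_dot F2 H2; have iG := in_L2_dot G2 H2.
rewrite -!RintegralZl// -RintegralD//.
- by apply: eq_Rintegral => x _; exact: dot_lin.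
- by apply: (integrableZl _ s iF).
- by apply: (integrableZl _ t iG).
Qed.

Lemma in_L2_bounded F (B : R) : (leb Omega < +oo)%E ->
  (forall k, measurable_fun Omega (component F k)) ->
  (forall x k, Omega x -> `|F x 0 k| <= B) -> in_L2 Omega F.
Proof.
move=> Ofin mF FB k; split => //.
apply: measurable_bounded_integrable => //.
  exact: measurable_funX.
exists (B ^+ 2); split; first exact: num_real.
move=> M BM x /= Ox; apply: le_trans (ltW BM).
by rewrite normrX lerXn2r ?nnegrE//; [exact: le_trans (FB x k Ox)|exact: FB].
Qed.

End square_integrable.

(** * Finite element functions on the mesh *)

Section mesh.
Context {R : realType} {d : nat} (M : fe_mesh R d).
Hypothesis hOmega : bounded_domain (Omega M).
Hypothesis hmesh : conforming_simplicial_mesh M.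
Local Notation leb := (lebesgue_rV R d).
Local Notation Omega := (Omega M).

Lemma Omega_open : open Omega. Proof. by case: hOmega. Qed.

Lemma Omega_measurable : measurable Omega.
Proof. exact: open_measurable_rV Omega_open. Qed.

Lemma Omega_finite : (leb Omega < +oo)%E.
Proof. by apply: lebesgue_rV_bounded_lty; [exact: Omega_measurable|case: hOmega]. Qed.

(** The inverse of the diffeomorphism gives [C^1] coordinates on a neighbourhood of
    the whole closed cell; the maps [p \o g] built from it extend the finite element
    functions across the boundary of the cell. *)
Lemma element_chart (K : cell M) : exists W (g : 'rV[R]_d -> 'rV[R]_d),
  [/\ open W, element K `<=` W,
      forall y, W y -> differentiable g y /\ forall v, {for y, continuous ('D_v g)},
      forall z, Khat z -> differentiable (geo K) z /\ g (geo K z) = z &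
      forall y, W y -> geo K (g y) = y].
Proof.
have [dK _ _ _] := hmesh; have [U [W [g [[_ oW] KU [dU dW] gU gW]]]] := dK K.
exists W, g; split => //.
- by move=> _ [z Kz <-]; have [] := gU z (KU z Kz).
- by move=> z Kz; have [_ ?] := gU z (KU z Kz); have [] := dU z (KU z Kz).
- by move=> y /gW[].
Qed.

Lemma geo_continuous (K : cell M) : {within Khat, continuous (geo K)}.
Proof.
have [W [g [_ _ _ dgeo _]]] := element_chart K.
apply: continuous_in_subspaceT => z /set_mem Kz.
by apply: differentiable_continuous; have [] := dgeo z Kz.
Qed.

Lemma element_compact (K : cell M) : compact (element K).
Proof. by apply: continuous_compact; [exact: geo_continuous|exact: Khat_compact]. Qed.

Lemma element_closed (K : cell M) : closed (element K).
Proof. by apply: compact_closed => //; exact: element_compact. Qed.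

Lemma closure_Omega_cover x : closure Omega x ->
  exists (K : cell M) z, Khat z /\ geo K z = x.
Proof.
have [_ -> _ _] := hmesh => -[K _ [z Kz zx]].
by exists K, z.
Qed.

Lemma element_closure (K : cell M) z : Khat z -> closure Omega (geo K z).
Proof. by have [_ -> _ _] := hmesh => Kz; exists K => //; exists z. Qed.

Lemma poly_on_bounded k (f : 'rV[R]_d -> R) :
  (forall K : cell M, poly_on k Khat (f \o geo K)) ->
  exists2 B : R, 0 <= B & forall x, closure Omega x -> `|f x| <= B.
Proof.
move=> fK; have /choice[B HB] : forall K : cell M, exists B : R, 0 <= B /\
    forall z, Khat z -> `|f (geo K z)| <= B.
  move=> K; have [p pp fp] := fK K.
  have [r [_ Hr]] := compact_bounded
    (continuous_compact (continuous_subspaceT (poly_fun_continuous pp)) (Khat_compact (R := R) (d := d))).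
  exists (`|r| + 1); split; first by rewrite addr_ge0.
  move=> z Kz; rewrite [f _](fp z Kz); apply: Hr; last by exists z.
  by rewrite ltr_pwDr// ler_norm.
exists (\sum_K B K); first by apply: sumr_ge0 => K _; exact: (HB K).1.
move=> x /closure_Omega_cover[K [z [Kz <-]]]; apply: le_trans ((HB K).2 z Kz) _.
by rewrite (bigD1 K)//= lerDl sumr_ge0// => L _; exact: (HB L).1.
Qed.

Lemma in_Vh_bounded v : in_Vh M v ->
  exists2 B : R, 0 <= B & forall x, Omega x -> `|v x| <= B.
Proof.
move=> [_ /poly_on_bounded[B B0 vB]]; exists B => // x Ox; apply: vB.
exact: subset_closure.
Qed.

Lemma in_Vh_measurable v : in_Vh M v -> measurable_fun Omega v.
Proof.
move=> [cv _]; apply: continuous_on_open_measurable; first exact: Omega_open.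
by move: cv; rewrite (continuous_open_subspace v Omega_open).
Qed.

Lemma poly_on_lin k (A : set 'rV[R]_d) (s t : R) (f g : 'rV[R]_d -> R) :
  poly_on k A f -> poly_on k A g -> poly_on k A (fun x => s * f x + t * g x).
Proof.
move=> [p pp fp] [q qq gq]; exists (fun x => s * p x + t * q x).
  exact: poly_fun_lin.
by move=> x Ax; rewrite fp// gq.
Qed.

Lemma in_Vh_lin (s t : R) f g : in_Vh M f -> in_Vh M g ->
  in_Vh M (fun x => s * f x + t * g x).
Proof.
move=> [cf pf] [cg pg]; split; last by move=> K; exact: (poly_on_lin s t (pf K) (pg K)).
move=> x; apply: (@cvgD _ R^o).
  by apply: (@cvgM _ _ _ _ (cst s)); [exact: cvg_cst|exact: cf].
by apply: (@cvgM _ _ _ _ (cst t)); [exact: cvg_cst|exact: cg].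
Qed.

Lemma in_Vh0 : in_Vh M (fun=> 0).
Proof.
split; first by move=> x; exact: cvg_cst.
by move=> K; exists (fun=> 0) => //; exact: poly_fun0.
Qed.

Lemma in_Vh3_lin (s t : R) f g : in_Vh3 M f -> in_Vh3 M g ->
  in_Vh3 M (fun x => s *: f x + t *: g x).
Proof.
move=> hf hg k; rewrite (_ : component _ k = (fun x => s * f x 0 k + t * g x 0 k)).
  exact: (in_Vh_lin s t (hf k) (hg k)).
by apply/funext => x; rewrite /component !mxE.
Qed.

Lemma in_Vh_sum (I : finType) (a : I -> R) (f : I -> 'rV[R]_d -> R) :
  (forall i, in_Vh M (f i)) -> in_Vh M (fun x => \sum_i a i * f i x).
Proof.
move=> hf; elim: (index_enum I) => [|i r IH].
  by under eq_fun do rewrite big_nil; exact: in_Vh0.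
have := in_Vh_lin (a i) 1 (hf i) IH.
by under eq_fun do rewrite mul1r; under [in X in _ -> X]eq_fun do rewrite big_cons.
Qed.

Section nodal.
Hypothesis hbasis : nodal_basis M.
Implicit Types i j : vertex M.

Lemma vertex_node (K : cell M) a : exists j, node (f:=M) j = geo K (Kvertex a).
Proof.
have [_ rn _ _] := hbasis.
have : [set x | exists (K : cell M) a, x = geo K (Kvertex a)] (geo K (Kvertex a)) by exists K, a.
by rewrite -rn => -[j _ <-]; exists j.
Qed.

Lemma hat_affine i (K : cell M) z : Khat z ->
  hat i (geo K z) = \sum_a bary z a * hat i (geo K (Kvertex a)).
Proof.
have [_ _ /(_ i)[_ /(_ K)[p pp hp]] _] := hbasis.
move=> Kz; rewrite [LHS](hp z Kz) (affine_bary pp); apply: eq_bigr => a _; congr (_ * _).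
by rewrite -hp//; exact: Khat_Kvertex.
Qed.

(** On a cell the nodal function is a convex combination of its values at the
    vertices, which are 0 or 1. *)
Lemma hat_ge0 i x : closure Omega x -> 0 <= hat i x.
Proof.
move=> /closure_Omega_cover[K [z [Kz <-]]]; rewrite hat_affine//.
apply: sumr_ge0 => a _; apply: mulr_ge0; first exact: Kz.
have [j <-] := vertex_node K a; have [_ _ _ ->] := hbasis.
exact: ler0n.
Qed.

(** At every vertex exactly one nodal function is 1, and the barycentric coordinates
    sum to 1. *)
Lemma sum_hat x : closure Omega x -> \sum_i hat (f:=M) i x = 1.
Proof.
move=> /closure_Omega_cover[K [z [Kz <-]]].
under eq_bigr do rewrite hat_affine//.
rewrite exchange_big/= -[RHS](sum_bary z); apply: eq_bigr => a _.
rewrite -mulr_sumr; have [j <-] := vertex_node K a.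
under eq_bigr do have [_ _ _ ->] := hbasis.
rewrite (bigD1 j)//= eqxx big1 ?addr0 ?mulr1// => i ij.
by rewrite (negPf ij).
Qed.

Lemma lumped_mass_nonneg i : 0 <= lumped_mass i.
Proof.
by apply: Rintegral_ge0 => x Ox; apply: hat_ge0; exact: subset_closure.
Qed.

Lemma hat_integrable i : leb.-integrable Omega (fun x => (hat i x)%:E).
Proof.
have [_ _ /(_ i) hi _] := hbasis; have [B B0 hB] := in_Vh_bounded hi.
apply: measurable_bounded_integrable.
- exact: Omega_measurable.
- exact: Omega_finite.
- exact: in_Vh_measurable.
- exists B; split; first exact: num_real.
  by move=> r Br x Ox /=; exact: le_trans (hB x Ox) (ltW Br).
Qed.

Lemma fe_vec_in_Vh3 (a : vertex M -> 'rV[R]_3) : in_Vh3 M (fe_vec a).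
Proof.
move=> k; rewrite (_ : component _ k = (fun x => \sum_i a i 0 k * hat i x)).
  by apply: in_Vh_sum => i; have [_ _ /(_ i)] := hbasis.
apply/funext => x; rewrite /component /fe_vec summxE.
by apply: eq_bigr => i _; rewrite mxE mulrC.
Qed.

Lemma fe_vec_node (a : vertex M -> 'rV[R]_3) j : fe_vec a (node j) = a j.
Proof.
have [_ _ _ hd] := hbasis.
rewrite /fe_vec (bigD1 j)//= hd eqxx scale1r big1 ?addr0// => i ij.
by rewrite hd (negPf ij) scale0r.
Qed.

End nodal.
End mesh.

(** * Linear combinations of edge element fields *)

Section test_fields.
Context {R : realType} {d : nat} (Omega : set 'rV[R]_d).
Implicit Types F : 'rV[R]_d -> 'rV[R]_3.

Lemma smooth_continuous (f : 'rV[R]_d -> R) v : smooth f ->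
  continuous f /\ continuous ('D_v f).
Proof.
move=> sf; split => x; apply: differentiable_continuous; first exact: (sf [::] x).
exact: (sf [:: v] x).
Qed.

Lemma bounded_of_compact_support (f : 'rV[R]_d -> R) (A : set 'rV[R]_d) :
  continuous f -> compact A -> (forall x, ~ A x -> f x = 0) ->
  exists2 B, 0 <= B & forall x, `|f x| <= B.
Proof.
move=> cf cA f0; have [r [_ Hr]] := compact_bounded
    (continuous_compact (continuous_subspaceT cf) cA).
exists (`|r| + 1); first by rewrite addr_ge0.
move=> x; have [Ax|nA] := pselect (A x); last by rewrite f0// normr0 addr_ge0.
by apply: Hr; [rewrite ltr_pwDr// ler_norm|exists x].
Qed.

Lemma derive_support (f : 'rV[R]_d -> R) (A : set 'rV[R]_d) v x :
  closed A -> (forall x, ~ A x -> f x = 0) -> ~ A x -> 'D_v f x = 0.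
Proof.
move=> cA f0 nA; rewrite -[RHS](derive_cst (0 : R) x v); apply: near_eq_derive.
have : \forall y \near x, ~ A y by apply: open_nbhs_nbhs; split => //; exact: closed_openC.
by apply: filterS => y /f0.
Qed.

Hypothesis mOmega : measurable Omega.
Hypothesis fOmega : (lebesgue_rV R d Omega < +oo)%E.

Lemma in_L2_compact_support F (A : set 'rV[R]_d) : compact A ->
  (forall k, continuous (component F k)) -> (forall x, ~ A x -> F x = 0) ->
  in_L2 Omega F.
Proof.
move=> cA cF F0.
have /choice[B HB] : forall k, exists B, 0 <= B /\ forall x, `|F x 0 k| <= B.
  move=> k; have [|B B0 FB] := @bounded_of_compact_support (component F k) A (cF k) cA.
    by move=> x /F0 Fx; rewrite /component Fx mxE.
  by exists B.
apply: (@in_L2_bounded _ _ _ mOmega F (\sum_k B k)) => //.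
  by move=> k; apply: measurable_funS (continuous_measurable_rV (cF k)).
move=> x k _; apply: le_trans ((HB k).2 x) _.
by rewrite (bigD1 k)//= lerDl sumr_ge0// => j _; exact: (HB j).1.
Qed.

(** Needed to split the integrals against a test field when weak curls are added. *)
Lemma test_field_L2 F : test_field Omega F -> in_L2 Omega F /\ in_L2 Omega (curl F).
Proof.
move=> [sF [A [cA _ F0]]].
have clA : closed A by apply: compact_closed => //.
have cF k := (smooth_continuous 0 (sF k)).1.
split; first exact: (in_L2_compact_support cA).
apply: (in_L2_compact_support cA) => [k|x nA].
  have -> : component (curl F) k = (fun x => 'D_(axis (k + 1)) (component F (k + 2%:R)) x
          - 'D_(axis (k + 2%:R)) (component F (k + 1)) x).
    by apply/funext => x; rewrite /component mxE.
  by apply: cts_sub; apply: (smooth_continuous _ (sF _)).2.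
have Fk k : forall x, ~ A x -> component F k x = 0.
  by move=> y /F0 Fy; rewrite /component Fy mxE.
by apply/rowP => k; rewrite !mxE !(derive_support _ clA (Fk _) nA) subrr.
Qed.

Lemma weak_curl_lin (s t : R) F G c c' : weak_curl Omega F c -> weak_curl Omega G c' ->
  weak_curl Omega (fun x => s *: F x + t *: G x) (fun x => s *: c x + t *: c' x).
Proof.
move=> [F2 c2 Fc] [G2 c'2 Gc]; split; [exact: in_L2_lin|exact: in_L2_lin|].
move=> T tT; have [T2 cT2] := test_field_L2 tT.
by rewrite !ipL2_lin// Fc// Gc.
Qed.

End test_fields.

Lemma cvg_lincomb0 (R : realType) (V : normedModType R) (T : Type) (F : set_system T)
    (s t : R) (f g : T -> V) : Filter F ->
  f x @[x --> F] --> (0 : V) -> g x @[x --> F] --> (0 : V) ->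
  s *: f x + t *: g x @[x --> F] --> (0 : V).
Proof.
move=> FF f0 g0; rewrite -[X in _ --> X](addr0 0) -[X in _ --> X + _](scaler0 _ s).
rewrite -[X in _ --> _ + X](scaler0 _ t).
by apply: cvgD; (apply: cvgZ; first exact: cvg_cst).
Qed.

Section edge_space.
Context {R : realType} {d : nat} (hd : d = 2%N \/ d = 3%N) (M : fe_mesh R d).
Hypothesis hOmega : bounded_domain (Omega M).
Hypothesis hmesh : conforming_simplicial_mesh M.
Implicit Types H : 'rV[R]_d -> 'rV[R]_3.
Local Notation leb := (lebesgue_rV R d).

Lemma embedE (n : 'rV[R]_d) (k : 'I_3) (kd : (k < d)%N) : embed n 0 k = n 0 (Ordinal kd).
Proof.
rewrite mxE /dot (bigD1 (Ordinal kd))//= mxE eqxx mulr1 big1 ?addr0// => j jk.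
rewrite mxE (_ : (j == k :> nat) = false) ?mulr0//.
by apply: contraNF jk => /eqP jk; apply/eqP/val_inj.
Qed.

Lemma embed_out (n : 'rV[R]_d) (k : 'I_3) : (d <= k)%N -> embed n 0 k = 0.
Proof.
move=> dk; rewrite mxE /dot big1// => j _.
rewrite mxE (_ : (j == k :> nat) = false) ?mulr0//.
by apply: contraTF dk => /eqP <-; rewrite -ltnNge.
Qed.

Lemma embed_planar (u : 'rV[R]_3) (k : 'I_3) : (k < d)%N ->
  embed (planar u : 'rV[R]_d) 0 k = u 0 k.
Proof.
move=> kd; rewrite (embedE _ kd) mxE; congr (u _ _).
by apply/val_inj; rewrite /= inordK.
Qed.

(** The in-plane components are square integrable as part of [in_Hcurl]; an
    out-of-plane component is a bounded function of [in_Vh]. *)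
Lemma in_Hh_L2 H : in_Hh M H -> in_L2 (Omega M) H.
Proof.
move=> [[c [H2 _ _]] _ Hz] k; have [kd|dk] := ltnP k d.
  have E : component (fun x => embed (planar (H x) : 'rV[R]_d)) k = component H k.
    by apply/funext => x; rewrite /component embed_planar.
  by have := H2 k; rewrite E.
have Vk := Hz k dk; have mO := Omega_measurable hOmega.
have [B B0 HB] := in_Vh_bounded hmesh Vk.
split; first exact: in_Vh_measurable.
apply: measurable_bounded_integrable => //.
- exact: Omega_finite.
- by apply: measurable_funX; exact: in_Vh_measurable.
exists (B ^+ 2); split; first exact: num_real.
move=> r Br x /= Ox; apply: le_trans (ltW Br).
by rewrite normrX lerXn2r ?nnegrE//; exact: HB.
Qed.

Lemma planar_lin (s t : R) (u v : 'rV[R]_3) :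
  planar (s *: u + t *: v) = s *: planar u + t *: planar v :> 'rV[R]_d.
Proof. by apply/rowP => j; rewrite !mxE. Qed.

Lemma embed_lin (s t : R) (u v : 'rV[R]_d) :
  embed (s *: u + t *: v) = s *: embed u + t *: embed v.
Proof. by apply/rowP => k; rewrite !mxE dot_lin. Qed.

Lemma cross_lin (s t : R) (u v w : 'rV[R]_3) :
  cross (s *: u + t *: v) w = s *: cross u w + t *: cross v w.
Proof. by apply/rowP => k; rewrite !mxE; ring. Qed.

Lemma in_Hh_lin (s t : R) H G : in_Hh M H -> in_Hh M G ->
  in_Hh M (fun x => s *: H x + t *: G x).
Proof.
move=> [[c Hc] HK Hz] [[c' Gc] GK Gz]; split.
- exists (fun x => s *: c x + t *: c' x).
  under eq_fun do rewrite planar_lin embed_lin.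
  by apply: weak_curl_lin => //; [exact: Omega_measurable|exact: Omega_finite].
- move=> K j; have := poly_on_lin s t (HK K j) (GK K j).
  congr (poly_on _ _ _); apply/funext => x.
  by rewrite /pull_back planar_lin mulmxDl -!scalemxAl !mxE.
- move=> k dk; have := in_Vh_lin s t (Hz k dk) (Gz k dk).
  by rewrite /component; under [in X in _ -> X]eq_fun do rewrite !mxE.
Qed.

Lemma tangential_trace0_lin (s t : R) H G :
  tangential_trace0 M H -> tangential_trace0 M G ->
  tangential_trace0 M (fun x => s *: H x + t *: G x).
Proof.
move=> tH tG K a Ka x n xK xn; have h1 := tH K a Ka x n xK xn; have h2 := tG K a Ka x n xK xn.
have -> : (fun y => cross (s *: H y + t *: G y) (embed n)) =
    (fun y => s *: cross (H y) (embed n) + t *: cross (G y) (embed n)).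
  by apply/funext => y; exact: cross_lin.
have FF : Filter (within (element K)° (nbhs x)) by exact: within_filter.
exact: (@cvg_lincomb0 R 'rV[R]_3 _ _ s t _ _ FF h1 h2).
Qed.

Lemma in_Hh0_lin (s t : R) H G : in_Hh0 M H -> in_Hh0 M G ->
  in_Hh0 M (fun x => s *: H x + t *: G x).
Proof.
by move=> [hH tH] [hG tG]; split; [exact: in_Hh_lin|exact: tangential_trace0_lin].
Qed.

End edge_space.

(** * The source step: energy, admissibility, entropy *)

Lemma Rintegral_bigsum (R : realType) dT (T : measurableType dT) (mu : {measure set T -> \bar R})
    (D : set T) (I : finType) (f : I -> T -> R) : measurable D ->
  (forall i, mu.-integrable D (EFin \o f i)) ->
  \int[mu]_(x in D) (\sum_i f i x) = \sum_i \int[mu]_(x in D) f i x.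
Proof.
move=> mD fi; rewrite /Rintegral.
under eq_integral do rewrite -sumEFin.
rewrite (integral_sum mD fi) -[RHS]/(fine (\sum_i _)%:E) -sumEFin; congr fine.
by apply: eq_bigr => i _; rewrite fineK//; exact: (integrable_fin_num mD (fi i)).
Qed.

(** The segment between the two states lies in the convex domain, and along it the
    derivative of [s] is a nonnegative multiple of its derivative in the energy. *)
Lemma entropy_nondecreasing (R : realType) (s : R * R -> R) (D : set (R * R)) v e1 e2 :
  equation_of_state s D -> D (v, e1) -> D (v, e2) -> e1 <= e2 -> s (v, e1) <= s (v, e2).
Proof.
move=> [cD _ [U [oU DU sU]] s_e _] D1 D2 e12.
pose w : R * R := (e2 - e1) *: dire; pose p : R * R := (v, e1).
pose G (t : R) : R := s (p + t *: w); pose G' (t : R) : R := 'D_w s (p + t *: w).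
have Dp t : t \in `[0, 1] -> D (p + t *: w).
  rewrite in_itv/= => /andP[t0 t1].
  have l0 : 0 <= 1 - t by rewrite subr_ge0.
  have l1 : 1 - t <= 1 by rewrite gerBl.
  have := cD (v, e1) (v, e2) (Itv01 l0 l1) (mem_set D1) (mem_set D2).
  move=> /set_mem; congr D.
  rewrite /conv/= /unstable.onem; congr pair.
    by change ((1 - t) * v + (1 - (1 - t)) * v = v + t * ((e2 - e1) * 0)); ring.
  by change ((1 - t) * e1 + (1 - (1 - t)) * e2 = e1 + t * ((e2 - e1) * 1)); ring.
have dGc (t : R) : t \in `[0, 1] -> is_derive t 1 G (G' t).
  move=> /Dp/DU/sU[ds _ _].
  by apply: is_derive_line; exact: diff_derivable.
have dG (t : R) : t \in `]0, 1[ -> is_derive t 1 G (G' t).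
  by move=> /subset_itv_oo_cc; exact: dGc.
have cG : {within `[0, 1], continuous G}.
  by apply: derivable_within_continuous => t /dGc[].
have [c c01] := MVT_segment ler01 dG cG.
have -> : G 0 = s (v, e1) by rewrite /G scale0r addr0.
have -> : G 1 = s (v, e2).
  rewrite /G scale1r; congr (s (_, _)).
    by change (v + (e2 - e1) * 0 = v); rewrite mulr0 addr0.
  by change (e1 + (e2 - e1) * 1 = e2); ring.
rewrite subr0 mulr1 => E; rewrite -subr_ge0 E /G'.
have Dc := Dp c c01; have [ds _ _] := sU _ (DU _ Dc).
rewrite deriveE// linearZ/= -deriveE// mulr_ge0 ?subr_ge0// ltW//; exact: s_e.
Qed.

Section vector_identities.
Context {R : realType}.
Implicit Types u v w : 'rV[R]_3.

Lemma dot_ge0 n (u : 'rV[R]_n) : 0 <= dot u u.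
Proof. by apply: sumr_ge0 => i _; rewrite -expr2 sqr_ge0. Qed.

Lemma dotZl n (s : R) (u v : 'rV[R]_n) : dot (s *: u) v = s * dot u v.
Proof. by rewrite /dot mulr_sumr; apply: eq_bigr => i _; rewrite mxE mulrA. Qed.

Lemma dotZZ n (s : R) (u : 'rV[R]_n) : dot (s *: u) (s *: u) = s ^+ 2 * dot u u.
Proof. by rewrite dotZl dotC dotZl mulrA. Qed.

Lemma dot0l n (v : 'rV[R]_n) : dot 0 v = 0.
Proof. by rewrite /dot big1// => i _; rewrite mxE mul0r. Qed.

Lemma dot_cross u v : dot (cross u v) u = 0.
Proof.
have e1 : (1 : 'I_3) + 2%:R = 0 by apply/val_inj.
have e2 : (2%:R : 'I_3) + 1 = 0 by apply/val_inj.
have e3 : (2%:R : 'I_3) + 2%:R = 1 by apply/val_inj.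
have e4 : (1 : 'I_3) + 1 = 2%:R by apply/val_inj.
by rewrite dotE !mxE !add0r e1 e2 e3 e4; ring.
Qed.

Lemma dot_midpoint n (u v : 'rV[R]_n) :
  dot (u - v) (2^-1 *: (v + u)) = 2^-1 * (dot u u - dot v v).
Proof.
rewrite dotC dotZl; congr (_ * _); rewrite /dot -sumrB; apply: eq_bigr => i _.
by rewrite !mxE; ring.
Qed.

End vector_identities.

Section source_step.
Context {R : realType} {d : nat} (M : fe_mesh R d).
Hypothesis hOmega : bounded_domain (Omega M).
Hypothesis hmesh : conforming_simplicial_mesh M.
Hypothesis hbasis : nodal_basis M.
Local Notation leb := (lebesgue_rV R d).
Local Notation Omega := (Omega M).

Lemma weighted_integrable (f b : 'rV[R]_d -> R) (B : R) :
  leb.-integrable Omega (EFin \o f) -> measurable_fun Omega b ->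
  (forall x, Omega x -> `|b x| <= B) ->
  leb.-integrable Omega (EFin \o (fun x => b x * f x)).
Proof.
move=> fi mb bB; have mO := Omega_measurable hOmega.
have := integrableZl mO B fi; apply: le_integrable => //.
  apply/measurable_EFinP; apply: measurable_funM => //.
  by apply/measurable_EFinP; exact: (measurable_int leb fi).
move=> x Ox /=; rewrite lee_fin !normrM ler_wpM2r//.
exact: le_trans (bB x Ox) (ler_norm _).
Qed.

(** For a zero lumped mass the quotient is meaningless, but then the nonnegative
    nodal function vanishes almost everywhere on the domain and so does the integrand. *)
Lemma mass_average (G : 'rV[R]_d -> R) (i : vertex M) :
  leb.-integrable Omega (EFin \o (fun x => G x * hat i x)) ->
  lumped_mass i * ((lumped_mass i)^-1 * \int[leb]_(x in Omega) (G x * hat i x)) =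
  \int[leb]_(x in Omega) (G x * hat i x).
Proof.
move=> Gi; have mO := Omega_measurable hOmega.
have [m0|m0] := eqVneq (lumped_mass i) 0; last by rewrite mulVKf.
rewrite m0 mul0r; apply/esym; rewrite /Rintegral.
have hi := hat_integrable hOmega hmesh hbasis i.
have h0 x : Omega x -> 0 <= hat i x.
  by move=> Ox; apply: hat_ge0 => //; exact: subset_closure.
have ae0 : ae_eq leb Omega (fun x => (hat i x)%:E) (cst 0%E).
  apply/(ae_eq_integral_abs leb mO (measurable_int _ hi)).
  rewrite (eq_integral (fun x => (hat i x)%:E)); last first.
    by move=> x /set_mem Ox /=; rewrite ger0_norm// h0.
  by rewrite -[LHS]fineK; [congr EFin|exact: integrable_fin_num].
rewrite (ae_eq_integral (cst 0%E)) ?integral0//.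
  exact: (measurable_int leb).
by apply: filterS ae0 => x h Ox; move: (h Ox) => /= [->]; rewrite mulr0.
Qed.

Variables (mu di r : R) (rh : 'rV[R]_d -> R).
Hypothesis hr : 0 < r.
Hypothesis hrh : in_Vh M rh.
Hypothesis hrh_ge : forall x, Omega x -> r <= rh x.
Variables (u1 u2 : hydro R (vertex M)) (H1 H2 : 'rV[R]_d -> 'rV[R]_3) (tau : R).
Hypothesis rho_gt0 : forall i, 0 < rho u1 i.
Hypothesis H1h : in_Hh0 M H1.
Hypothesis src : source_update mu di rh u1 H1 tau u2 H2.

(** The midpoint velocity and the midpoint field are admissible test functions. In
    the two tested equations the work of the Lorentz force is the same integral, so
    eliminating it leaves a balance between the changes of kinetic and magnetic
    energy and the Joule heat, which is exactly what the update adds to [ene]. *)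
Lemma source_update_energy :
  \sum_i lumped_mass i * ene u2 i + mu / 2 * ipL2 Omega H2 H2 =
  \sum_i lumped_mass i * ene u1 i + mu / 2 * ipL2 Omega H1 H1.
Proof.
have mO := Omega_measurable hOmega.
case: src => v2 [cH]; set v1 := fe_vec _.
move=> [[hv2 hH2] wc eq1 eq2 upd].
have L1 := in_Hh_L2 hOmega hmesh H1h.1.
have L2 := in_Hh_L2 hOmega hmesh hH2.1.
have [Lbar Lc _] := wc.
have hv1 : in_Vh3 M v1 by exact: fe_vec_in_Vh3.
have hvbar : in_Vh3 M (fun x => 2^-1 *: (v1 x + v2 x)).
  by under eq_fun do rewrite scalerDr; exact: in_Vh3_lin.
have hHbar : in_Hh0 M (fun x => 2^-1 *: (H1 x + H2 x)).
  by under eq_fun do rewrite scalerDr; exact: in_Hh0_lin.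
have {}eq1 := eq1 _ hvbar; have {}eq2 := eq2 _ _ hHbar wc.
set X := ipL2 _ (fun x => cross (cH x) _) _ in eq1 eq2.
(* the cross product is orthogonal to its factor [cH] *)
have hall0 : ipL2 Omega (fun x => (fe_scal (rho u1) x)^-1 *:
    cross (cH x) (2^-1 *: (H1 x + H2 x))) cH = 0.
  rewrite /ipL2 (_ : (fun x => _) = cst 0) ?Rintegral_cst ?mul0r//.
  by apply/funext => x; rewrite dotZl dot_cross mulr0.
rewrite hall0 mulr0 addr0 in eq2.
have magn : ipL2 Omega (fun x => H2 x - H1 x) (fun x => 2^-1 *: (H1 x + H2 x)) =
    2^-1 * (ipL2 Omega H2 H2 - ipL2 Omega H1 H1).
  have i1 := in_L2_dot mO L1 L1; have i2 := in_L2_dot mO L2 L2.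
  rewrite /ipL2 -RintegralB// -RintegralZl//; last exact: (integrableB mO i2 i1).
  by apply: eq_Rintegral => x _; exact: dot_midpoint.
have kin : lumped_ip (rho u1) (fun x => v2 x - v1 x) (fun x => 2^-1 *: (v1 x + v2 x)) =
    \sum_i lumped_mass i * (2^-1 * (dot (mom u2 i) (mom u2 i) / rho u1 i)
          - 2^-1 * (dot (mom u1 i) (mom u1 i) / rho u1 i)).
  apply: eq_bigr => i _; rewrite -mulrA; congr (_ * _).
  have ri : rho u1 i != 0 by rewrite gt_eqF.
  have [_ -> _] := upd i.
  have -> : mom u1 i = rho u1 i *: v1 (node i).
    by rewrite /v1 fe_vec_node// scalerA mulfV// scale1r.
  rewrite dot_midpoint !dotZZ.
  by field.
have joule : \sum_(i : vertex M) lumped_mass i * ((lumped_mass i)^-1 *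
      \int[leb]_(x in Omega) (rh x * dot (cH x) (cH x) * hat i x)) =
    ipL2 Omega (fun x => rh x *: cH x) cH.
  have ic := in_L2_dot mO Lc Lc.
  have [B B0 rB] := in_Vh_bounded hmesh hrh.
  have ir : leb.-integrable Omega (EFin \o (fun x => rh x * dot (cH x) (cH x))).
    by apply: (@weighted_integrable (fun x => dot (cH x) (cH x)) rh B ic _ rB); exact: in_Vh_measurable.
  have ih (i : vertex M) : leb.-integrable Omega (EFin \o (fun x => rh x * dot (cH x) (cH x) * hat i x)).
    have [_ _ /(_ i) hi _] := hbasis; have [C _ hC] := in_Vh_bounded hmesh hi.
    under eq_fun do rewrite mulrC.
    by apply: (@weighted_integrable (fun x => rh x * dot (cH x) (cH x)) (hat i) C ir _ hC);
      exact: in_Vh_measurable.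
  under eq_bigr do rewrite mass_average//.
  rewrite -(Rintegral_bigsum mO ih).
  apply: eq_Rintegral => x /set_mem Ox.
  by rewrite -mulr_sumr sum_hat ?mulr1 ?dotZl//; exact: subset_closure.
have ene2 : \sum_i lumped_mass i * ene u2 i = \sum_i lumped_mass i * ene u1 i +
   lumped_ip (rho u1) (fun x => v2 x - v1 x) (fun x => 2^-1 *: (v1 x + v2 x)) +
   tau * ipL2 Omega (fun x => rh x *: cH x) cH.
  rewrite kin -joule mulr_sumr -!big_split/=; apply: eq_bigr => i _.
  by have [_ _ ->] := upd i; ring.
rewrite magn in eq2; rewrite ene2.
by rewrite -/v1 in eq1 *; lra.
Qed.

Lemma joule_heating_ge0 (c : 'rV[R]_d -> 'rV[R]_3) (i : vertex M) :
  0 <= (lumped_mass i)^-1 * \int[leb]_(x in Omega) (rh x * dot (c x) (c x) * hat i x).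
Proof.
apply: mulr_ge0; first by rewrite invr_ge0 lumped_mass_nonneg.
apply: Rintegral_ge0 => x Ox; apply: mulr_ge0; first apply: mulr_ge0.
- exact: le_trans (ltW hr) (hrh_ge Ox).
- exact: dot_ge0.
- by apply: hat_ge0 => //; exact: subset_closure.
Qed.

(** All that admissibility and entropy use of the source step: besides
    exchanging kinetic energy, it only adds heat. *)
Lemma source_update_heating : 0 <= tau -> forall i, rho u2 i = rho u1 i /\
  exists2 q : R, 0 <= q &
   ene u2 i = ene u1 i + 2^-1 * (dot (mom u2 i) (mom u2 i) / rho u1 i)
          - 2^-1 * (dot (mom u1 i) (mom u1 i) / rho u1 i) + q.
Proof.
move=> tau0 i; case: src => v2 [cH] /= [_ _ _ _ /(_ i)[-> _ E]]; split => //.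
by eexists; last exact: E; apply: mulr_ge0 => //; exact: joule_heating_ge0.
Qed.

Lemma source_update_admissible : 0 <= tau -> admissible u1 -> admissible u2.
Proof.
move=> tau0 adm i; have [rE [q q0 eE]] := source_update_heating tau0 i.
have [r0 e0] := adm i; rewrite rE eE; split => //.
move: e0; rewrite invfM; set k2 := dot (mom u2 i) _; set k1 := dot (mom u1 i) _.
rewrite -!mulrA [_ * k1]mulrC [_ * k2]mulrC; lra.
Qed.

Lemma source_update_entropy (s : R * R -> R) (D : set (R * R)) :
  equation_of_state s D -> 0 <= tau ->
  (forall i, D (thermo u1 i)) -> (forall i, D (thermo u2 i)) ->
  \sum_i lumped_mass i * math_entropy s u2 i <= \sum_i lumped_mass i * math_entropy s u1 i.
Proof.
move=> hs tau0 D1 D2; apply: ler_sum => i _.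
rewrite ler_wpM2l ?lumped_mass_nonneg// /math_entropy.
have [rE [q q0 eE]] := source_update_heating tau0 i.
have r0 := rho_gt0 i.
have := D2 i; have := D1 i; rewrite /thermo rE => D1i D2i.
rewrite !mulNr lerN2; apply: ler_wpM2l; first exact: ltW.
apply: (entropy_nondecreasing hs D1i D2i).
rewrite /internal_energy eE rE.
have ri : rho u1 i != 0 by rewrite gt_eqF.
rewrite -subr_ge0; set Z := (X in 0 <= X).
have -> : Z = q / rho u1 i by rewrite /Z; field.
by rewrite divr_ge0// ltW.
Qed.

End source_step.

(** * Gradients of scalar finite element functions *)

Lemma cts_at_sum (R : realType) (V : normedModType R) (T : topologicalType) (I : finType)
    (x : T) (f : I -> T -> V) :
  (forall i, {for x, continuous (f i)}) -> {for x, continuous (fun z => \sum_i f i z)}.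
Proof.
move=> cf; elim: (index_enum I) => [|i s IH].
  have -> : (fun z => \sum_(i <- [::]) f i z) = cst 0 by apply/funext => z; rewrite big_nil.
  exact: cst_continuous.
have -> : (fun z => \sum_(j <- i :: s) f j z) = (fun z => f i z + \sum_(j <- s) f j z).
  by apply/funext => z; rewrite big_cons.
exact: (@continuousD _ V T (f i) (fun z => \sum_(j <- s) f j z) x (cf i) IH).
Qed.

Lemma cross_delta (R : realType) (u v : 'rV[R]_3) :
  cross u v = \sum_k u 0 k *: cross (delta_mx 0 k) v.
Proof.
rewrite {1}[u]row_sum_delta; elim: (index_enum _) => [|k r IH].
  by rewrite !big_nil; apply/rowP => k; rewrite !mxE; ring.
by rewrite !big_cons -IH -[X in cross (_ + X) _]scale1r cross_lin scale1r.
Qed.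

(** A [C^1] function is a piecewise one with a single piece. *)
Lemma compact_support_C1_lipschitz (R : realType) (d : nat) (f : 'rV[R]_d -> R)
    (A : set 'rV[R]_d) : (forall x, differentiable f x) ->
  (forall v, continuous ('D_v f)) -> compact A -> (forall x, ~ A x -> f x = 0) ->
  exists L, lipschitz_with L f.
Proof.
move=> df cf cA f0; have clA : closed A by apply: compact_closed => //.
have /choice[B HB] : forall j, exists B, 0 <= B /\ forall x, `|'D_(delta_mx 0 j) f x| <= B.
  move=> j; have [|B B0 fB] := bounded_of_compact_support (cf (delta_mx 0 j)) cA.
    by move=> x nA; exact: (derive_support _ clA f0 nA).
  by exists B.
have L0 : 0 <= \sum_j B j by apply: sumr_ge0 => j _; exact: (HB j).1.
exists (\sum_j B j).
apply: (@piecewise_C1_lipschitz R d unit (fun=> setT) (fun=> setT) (fun=> f) f) => //.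
- by move=> _ x _; split => // v; exact: cf.
move=> _ x v _; rewrite derive_sum_coord//.
apply: le_trans (ler_norm_sum _ _ _) _; rewrite mulr_suml; apply: ler_sum => j _.
by rewrite normrM mulrC ler_pM//; [exact: (HB j).2|exact: coord_norm_le].
Qed.

(** Used on the boundary of the simplex, where information about [f] is available on
    one side only. *)
Lemma derive_right_limit (R : realType) (V W : normedModType R) (f : V -> W) x v
    (A : set W) : closed A -> derivable f x v ->
  (\forall t \near (0 : R)^'+, A (t^-1 *: (f (x + t *: v) - f x))) -> A ('D_v f x).
Proof.
move=> cA dfx At.
have dfr : t^-1 *: (f (x + t *: v) - f x) @[t --> (0 : R)^'+] --> 'D_v f x.
  move=> B /dfx B0.
  have : \forall t \near (0 : R), t != 0 -> B (t^-1 *: (f (x + t *: v) - f x)).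
    apply: (@filterS _ (nbhs (0 : R)) _ _ _ _ B0) => t /= + t0 => /(_ t0).
    by rewrite [t *: v + x]addrC.
  by apply: filterS => t h t0; apply: h; rewrite gt_eqF.
exact: (@closed_cvg _ _ _ _ (fun t : R => t^-1 *: (f (x + t *: v) - f x)) A cA At _ dfr).
Qed.

Section facets.
Context {R : realType} {d : nat}.
Implicit Types (x y z u : 'rV[R]_d) (a b c : 'I_d.+1).

Lemma bary_segment z y (t : R) c :
  bary (z + t *: (y - z)) c = (1 - t) * bary z c + t * bary y c.
Proof.
case: (unliftP ord0 c) => [j ->|->]; first by rewrite !bary_lift !mxE; ring.
rewrite !bary0 (_ : \sum_j (z + t *: (y - z)) 0 j =
   (1 - t) * (\sum_j z 0 j) + t * \sum_j y 0 j); first by ring.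
by rewrite !mulr_sumr -big_split/=; apply: eq_bigr => j _; rewrite !mxE; ring.
Qed.

Lemma Kfacet_segment a b z (t : R) : Kfacet a z -> b != a -> 0 <= t <= 1 ->
  Kfacet a (z + t *: (Kvertex b - z)).
Proof.
move=> [Kz za] ba /andP[t0 t1]; split=> [c|c ca]; rewrite bary_segment bary_Kvertex.
  by rewrite addr_ge0 ?mulr_ge0 ?subr_ge0.
rewrite za// mulr0 add0r; move: ca; rewrite !inE negbK => /eqP ->.
by rewrite (negPf ba) mulr0.
Qed.

(** The vectors [Kvertex b - z] with [b != a] span the directions of the facet
    opposite to vertex [a]; a linear form that vanishes on them is a multiple of the
    linear part of the barycentric coordinate [a]. Writing a vector with the linear
    parts of all barycentric coordinates as coefficients, which sum to zero, makes the
    multiple explicit. *)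
Lemma facet_functional (L : 'rV[R]_d -> R) a z :
  (forall (s : R) u v, L (s *: u + v) = s * L u + L v) ->
  (forall b, b != a -> L (Kvertex b - z) = 0) ->
  forall u, L u = (bary u a - bary 0 a) * L (Kvertex a - z).
Proof.
move=> linL L0 u; pose l b := bary u b - bary 0 b.
have L00 : L 0 = 0.
  by have := linL 1 0 0; rewrite scaler0 addr0 mul1r => /eqP; rewrite -subr_eq0 opprD addNKr oppr_eq0 => /eqP.
have Lsum (r : seq 'I_d.+1) (f : 'I_d.+1 -> 'rV[R]_d) :
    L (\sum_(b <- r) l b *: f b) = \sum_(b <- r) l b * L (f b).
  by elim: r => [|b r IH]; rewrite ?big_nil// !big_cons linL IH.
have uE : u = \sum_b l b *: (Kvertex b - z).
  apply/rowP => j; rewrite summxE.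
  under eq_bigr do rewrite mxE mxE [(- z) _ _]mxE mulrBr.
  rewrite sumrB -mulr_suml /l sumrB !sum_bary subrr mul0r subr0.
  under eq_bigr do rewrite mulrBl.
  by rewrite sumrB !sum_bary_vertex mxE subr0.
rewrite [in LHS]uE Lsum (bigD1 a)//= big1 ?addr0// => b ba.
by rewrite L0// mulr0.
Qed.

End facets.

Section scalar_potential.
Context {R : realType} {d : nat} (M : fe_mesh R d).
Hypothesis hOmega : bounded_domain (Omega M).
Hypothesis hmesh : conforming_simplicial_mesh M.
Local Notation leb := (lebesgue_rV R d).
Local Notation Omega := (Omega M).

Lemma boundaryP x : boundary Omega x <-> closure Omega x /\ ~ Omega x.
Proof.
have oO := Omega_open hOmega; have -> : boundary Omega = closure Omega `\` Omega.
  by rewrite /boundary (interior_id Omega).1.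
by [].
Qed.

(** The derivative is a finite sum of products of continuous functions, by the chain
    rule. *)
Lemma poly_comp_C1 (W : set 'rV[R]_d) (g : 'rV[R]_d -> 'rV[R]_d) k (p : 'rV[R]_d -> R) :
  open W ->
  (forall y, W y -> differentiable g y /\ forall v, {for y, continuous ('D_v g)}) ->
  poly_fun k p -> forall y, W y ->
  differentiable (p \o g) y /\ forall v, {for y, continuous ('D_v (p \o g))}.
Proof.
move=> oW gW pp y Wy; have [dp Dp] := poly_fun_diff pp; have [dg cDg] := gW y Wy.
split; first exact: differentiable_comp.
move=> v.
have E : \forall z \near y, \sum_j ('D_v g z) 0 j * 'D_(delta_mx 0 j) p (g z) = 'D_v (p \o g) z.
  have : \forall z \near y, W z by apply: open_nbhs_nbhs.
  apply: filterS => z Wz; rewrite [RHS]derive_comp//; last exact: (gW z Wz).1.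
  by rewrite derive_sum_coord.
have Ey := nbhs_singleton E.
suff : (fun z => \sum_j ('D_v g z) 0 j * 'D_(delta_mx 0 j) p (g z)) z @[z --> y] -->
   \sum_j ('D_v g y) 0 j * 'D_(delta_mx 0 j) p (g y).
  by rewrite Ey => H; apply: cvg_trans H; exact: near_eq_cvg E.
apply: (@cts_at_sum _ R^o) => j.
apply: (@continuousM _ 'rV[R]_d (fun z => ('D_v g z) 0 j) (fun z => 'D_(delta_mx 0 j) p (g z))).
  apply: (@continuous_comp _ _ _ ('D_v g) (fun u : 'rV[R]_d => u 0 j)); first exact: cDg.
  exact: coord_continuous.
apply: (@continuous_comp _ _ _ g ('D_(delta_mx 0 j) p)); first exact: differentiable_continuous.
exact: (poly_fun_continuous (Dp j)).
Qed.

Lemma poly_on_C1_extension k (f : 'rV[R]_d -> R) (K : cell M) : poly_on k Khat (f \o geo K) ->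
  exists W q, [/\ open W, element K `<=` W,
    forall y, W y -> differentiable q y /\ forall v, {for y, continuous ('D_v q)} &
    forall y, element K y -> f y = q y].
Proof.
move=> [p pp fp]; have [W [g [oW KW gW gK _]]] := element_chart hmesh K.
exists W, (p \o g); split => //; first exact: (poly_comp_C1 oW gW pp).
by move=> _ [z Kz <-]; rewrite /= (gK z Kz).2 -fp.
Qed.

Variable w : 'rV[R]_d -> R.
Hypothesis hw : in_Ph0 M w.

(** Vanishing on the boundary makes this extension continuous, so that integrals over
    the domain become integrals over the whole space without boundary terms. *)
Definition zero_extension (x : 'rV[R]_d) : R := if `[< Omega x >] then w x else 0.
Local Notation wt := zero_extension.

(** The pieces are the closed cells, where [w] is a polynomial in the chart, and the
    complement of the domain, where the extension is zero; on the boundary both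
    descriptions agree because [w] vanishes there. *)
Lemma zero_extension_regular :
  (exists L, lipschitz_with L wt) /\ forall v, {ae leb, forall x, derivable wt x v}.
Proof.
have [[_ pw] w0] := hw.
have /choice[Wq HWq] : forall K : cell M, exists Wq : set 'rV[R]_d * ('rV[R]_d -> R),
    [/\ open Wq.1, element K `<=` Wq.1,
    forall y, Wq.1 y -> differentiable Wq.2 y /\ forall v, {for y, continuous ('D_v Wq.2)} &
    forall y, element K y -> w y = Wq.2 y].
  by move=> K; have [W [q ?]] := poly_on_C1_extension (pw K); exists (W, q).
pose C (i : option (cell M)) := if i is Some K then element K else ~` Omega.
pose V (i : option (cell M)) := if i is Some K then (Wq K).1 else setT.
pose q (i : option (cell M)) := if i is Some K then (Wq K).2 else cst 0.
have cC i : closed (C i).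
  case: i => [K|]; first exact: element_closed.
  exact: open_closedC (Omega_open hOmega).
have covC x : exists i, C i x.
  have [Ox|nO] := pselect (Omega x); last by exists None.
  have [K [z [Kz zx]]] := closure_Omega_cover hmesh (subset_closure Ox).
  by exists (Some K), z.
have oV i : open (V i) by case: i => [K|]; [case: (HWq K)|exact: openT].
have CV i : C i `<=` V i by case: i => [K|//]; case: (HWq K).
have qC1 i x : V i x -> differentiable (q i) x /\ forall v, {for x, continuous ('D_v (q i))}.
  case: i => [K|_]; first by case: (HWq K) => _ _ + _ => /(_ x).
  split; first exact: differentiable_cst.
  move=> v; have -> : 'D_v (q None) = cst 0 by apply/funext => y; exact: derive_cst.
  exact: cst_continuous.
have wq i x : C i x -> wt x = q i x.
  case: i => [K /= Kx|/= nO]; last by rewrite /wt asboolF.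
  have [_ _ _ <-//] := HWq K; rewrite /wt; case: asboolP => // nO; apply/esym/w0.
  apply/boundaryP; split => //; case: Kx => z Kz <-; exact: element_closure.
split; last by move=> v; exact: (piecewise_C1_derivable_ae cC covC oV CV qC1 wq).
have /choice[B HB] : forall p : option (cell M) * 'I_d, exists B : R, 0 <= B /\
    forall x, C p.1 x -> `|'D_(delta_mx 0 p.2) (q p.1) x| <= B.
  move=> [[K|] j]; last first.
    by exists 0; split => // x _; rewrite derive_cst normr0.
  have cD : {within element K, continuous ('D_(delta_mx 0 j) (Wq K).2)}.
    apply: continuous_in_subspaceT => x /set_mem Kx.
    by have [_ KW HC _] := HWq K; exact: (HC x (KW x Kx)).2.
  have cK := @element_compact _ _ M hmesh K.
  have [r [_ Hr]] := compact_bounded (continuous_compact cD cK).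
  exists (`|r| + 1); split; first by rewrite addr_ge0.
  by move=> x Kx; apply: Hr; [rewrite ltr_pwDr// ler_norm|exists x].
have L0 : 0 <= \sum_p B p by apply: sumr_ge0 => p _; exact: (HB p).1.
exists (\sum_p B p).
apply: (piecewise_C1_lipschitz cC covC CV qC1 wq L0) => i x v Cx.
rewrite derive_sum_coord; last exact: (qC1 i x (CV i x Cx)).1.
apply: le_trans (ler_norm_sum _ _ _) _.
apply: (@le_trans _ _ (\sum_j B (i, j) * `|v|)).
  apply: ler_sum => j _; rewrite normrM mulrC ler_pM//; first exact: (HB (i, j)).2.
  exact: coord_norm_le.
rewrite -mulr_suml ler_wpM2r//.
rewrite (eq_bigr (fun p => B (p.1, p.2))); last by case.
rewrite -(pair_bigA _ (fun i j => B (i, j)))/= (bigD1 i)//= lerDl.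
by apply: sumr_ge0 => i' _; apply: sumr_ge0 => j _; exact: (HB (i', j)).1.
Qed.

Lemma derive_zero_extension x v : Omega x -> 'D_v w x = 'D_v wt x.
Proof.
move=> Ox; apply: near_eq_derive.
have : \forall y \near x, Omega y by apply: open_nbhs_nbhs; split => //; exact: Omega_open.
by apply: filterS => y Oy; rewrite /wt asboolT.
Qed.

Lemma grad_L2 : in_L2 Omega (grad w).
Proof.
have [[L wL] _] := zero_extension_regular; have mO := Omega_measurable hOmega.
have cw := lipschitz_with_continuous wL.
have gE k : component (grad w) k = 'D_(axis k) w.
  by apply/funext => x; rewrite /component mxE.
apply: (@in_L2_bounded _ _ _ mO _ (\sum_k L * `|@axis R d k|)).
- exact: Omega_finite.
- move=> k; rewrite gE; apply: (eq_measurable_fun ('D_(axis k) wt)).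
    by move=> x /set_mem Ox; rewrite derive_zero_extension.
  by apply: measurable_funS (measurable_derive _ cw).
- move=> x k Ox; rewrite mxE derive_zero_extension//.
  apply: le_trans (derive_bound _ _ wL) _.
  by rewrite (bigD1 k)//= lerDl sumr_ge0// => j _; rewrite mulr_ge0//; exact: wL.1.
Qed.

(** The integrand is a cyclic sum of terms $\partial_a w\, \partial_b F_c$ in which
    every pair of directions occurs in both orders with opposite signs, and
    [integral_derive_swap] makes the two orders equal. *)
Lemma weak_curl_grad : weak_curl Omega (grad w) (fun=> 0).
Proof.
have [[L wL] wae] := zero_extension_regular; have mO := Omega_measurable hOmega.
have fO := Omega_finite hOmega.
have cw := lipschitz_with_continuous wL.
split; first exact: grad_L2.
  apply: (@in_L2_bounded _ _ _ mO _ 0) => //.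
    move=> k; rewrite (_ : component _ k = cst 0)//.
    by apply/funext => x; rewrite /component mxE.
  by move=> x k _; rewrite mxE normr0.
move=> F [sF [A [cA AO F0]]].
have -> : ipL2 Omega (fun=> 0) F = 0.
  rewrite /ipL2 (_ : (fun x => _) = cst 0) ?Rintegral_cst ?mul0r//.
  by apply/funext => x; rewrite dot0l.
have clA : closed A by apply: compact_closed => //.
have Fc0 c x : ~ A x -> component F c x = 0 by move=> /F0 Fx; rewrite /component Fx mxE.
pose T (a b c : 'I_3) x := 'D_(axis a) w x * 'D_(axis b) (component F c) x.
have Tint a b c : leb.-integrable Omega (EFin \o T a b c).
  have cD := (smooth_continuous (axis b) (sF c)).2.
  have [|B B0 DB] := bounded_of_compact_support cD cA.
    by move=> x nA; exact: (derive_support _ clA (Fc0 c) nA).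
  have [mG _] := grad_L2 a; apply: measurable_bounded_integrable => //.
    apply: measurable_funM; last by apply: measurable_funS (continuous_measurable_rV cD).
    apply: (eq_measurable_fun (component (grad w) a)) => // x _.
    by rewrite /component mxE.
  exists (L * `|@axis R d a| * B); split; first exact: num_real.
  move=> r Lr x /= Ox; apply: le_trans (ltW Lr); rewrite /T normrM ler_pM//.
  by rewrite derive_zero_extension//; exact: derive_bound.
pose J a b c := \int[leb]_(x in Omega) T a b c x.
have Jsym a b c : J a b c = J b a c.
  have JE a' b' : J a' b' c =
      \int[leb]_x ('D_(axis a') wt x * 'D_(axis b') (component F c) x).
    rewrite /J Rintegral_mkcond; apply: eq_Rintegral => x _.
    rewrite patchE; case: ifPn => [/set_mem Ox|/negP nO].
      by rewrite /T derive_zero_extension.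
    rewrite (derive_support _ clA (Fc0 c)) ?mulr0// => /AO Ox.
    by apply: nO; exact/mem_set.
  have dF x : differentiable (component F c) x := sF c [::] x.
  have [Lf fL] := compact_support_C1_lipschitz dF
    (fun v => (smooth_continuous v (sF c)).2) cA (Fc0 c).
  have [r [_ Hr]] := compact_bounded cA.
  rewrite !JE; apply: (@integral_derive_swap _ _ _ _ _ _ L Lf (`|r| + 1) wL fL) => //.
  - move=> x rx; apply: Fc0 => Ax; have r1 : r < `|r| + 1 by rewrite ltr_pwDr// ler_norm.
    have : `|x| <= `|r| + 1 := Hr _ r1 x Ax.
    by rewrite leNgt rx.
  - by move=> x; exact: diff_derivable.
  - by move=> x; exact: diff_derivable.
have e4 : (1 : 'I_3) + 1 = 2%:R by apply/val_inj.
have e1 : (1 : 'I_3) + 2%:R = 0 by apply/val_inj.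
have e2 : (2%:R : 'I_3) + 1 = 0 by apply/val_inj.
have e3 : (2%:R : 'I_3) + 2%:R = 1 by apply/val_inj.
have dE x : dot (grad w x) (curl F x) =
    (T 0 1 2%:R x - T 0 2%:R 1 x) + (T 1 2%:R 0 x - T 1 0 2%:R x)
    + (T 2%:R 0 1 x - T 2%:R 1 0 x).
  by rewrite dotE !mxE !add0r e1 e2 e3 e4 /T -!mulrBr.
have iB a b c a' b' c' := integrableB mO (Tint a b c) (Tint a' b' c').
rewrite /ipL2 (funext dE).
rewrite RintegralD//; last exact: iB; last exact: (integrableD mO (iB _ _ _ _ _ _) (iB _ _ _ _ _ _)).
rewrite RintegralD//; [|exact: iB|exact: iB].
rewrite !RintegralB// -!/(J _ _ _).
rewrite (Jsym 1 0) (Jsym 2%:R 0) (Jsym 2%:R 1).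
by move: (J 0 1 _) (J 1 _ 0) (J 0 _ 1) => x y z; ring.
Qed.

Lemma grad_out (k : 'I_3) x : (d <= k)%N -> grad w x 0 k = 0.
Proof.
move=> dk; rewrite mxE (_ : axis k = 0) ?derive0//.
apply/rowP => j; rewrite !mxE (_ : (j == k :> nat) = false)//.
by apply: contraTF dk => /eqP <-; rewrite -ltnNge.
Qed.

Lemma embed_planar_grad x : embed (planar (grad w x) : 'rV[R]_d) = grad w x.
Proof.
apply/rowP => k; have [kd|dk] := ltnP k d; first exact: embed_planar.
by rewrite embed_out// grad_out.
Qed.

Lemma axis_delta (j : 'I_d) : (d <= 3)%N -> axis (inord j) = delta_mx 0 j :> 'rV[R]_d.
Proof.
move=> d3; apply/rowP => i; rewrite !mxE eqxx/= inordK//.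
exact: leq_trans (ltn_ord j) d3.
Qed.

(** The chart pulls the interior of the reference simplex back to an open set. *)
Lemma near_element (K : cell M) (W : set 'rV[R]_d) (g : 'rV[R]_d -> 'rV[R]_d) z :
  open W -> (forall y, W y -> differentiable g y) -> (forall y, W y -> geo K (g y) = y) ->
  W (geo K z) -> g (geo K z) = z -> Khat° z ->
  \forall y \near geo K z, element K y.
Proof.
move=> oW dg gW Wz gz Kz.
have : \forall y \near geo K z, Khat (g y).
  have := differentiable_continuous (dg _ Wz); apply.
  by rewrite gz.
have : \forall y \near geo K z, W y by apply: open_nbhs_nbhs.
by apply: filterS2 => y Wy Ky; exists (g y) => //; exact: gW.
Qed.

(** By the chain rule the pulled-back gradient is the gradient of [w \o geo K], a
    polynomial of degree 2, so its components have degree 1. *)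
Lemma pull_back_grad (K : cell M) (j : 'I_d) : (d <= 3)%N ->
  poly_on 1 (Khat°) (fun z => pull_back K (grad w) z 0 j).
Proof.
move=> d3; have [[_ /(_ K)[p pp wp]] _] := hw; have [dp Dp] := poly_fun_diff pp.
have [W [g [oW KW gW gK geoW]]] := element_chart hmesh K.
exists ('D_(delta_mx 0 j) p); first exact: Dp.
move=> z iKz; have Kz : Khat z := interior_subset iKz.
have Wz : W (geo K z) by apply: KW; exists z.
have [dgeo gz] := gK z Kz.
have qC1 := poly_comp_C1 oW gW pp.
have nearK := near_element oW (fun y Wy => (gW y Wy).1) geoW Wz gz iKz.
have wq : \forall y \near geo K z, w y = (p \o g) y.
  by apply: filterS nearK => _ [z' Kz' <-]; rewrite /= (gK z' Kz').2 -wp.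
have dq := (qC1 _ Wz).1.
rewrite /pull_back mxE.
transitivity ('D_('D_(delta_mx 0 j) (geo K) z) (p \o g) (geo K z)).
  rewrite [RHS]derive_sum_coord//; apply: eq_bigr => i _.
  rewrite !mxE axis_delta// (near_eq_derive _ wq) mulrC; congr (_ * _).
  by rewrite deriveE.
rewrite -derive_comp//; apply: near_eq_derive.
have : \forall y \near z, Khat y by [].
by apply: filterS => y Ky; rewrite /= (gK y Ky).2.
Qed.

(** A boundary point near [x] is neither in the domain nor outside its closure, so its
    offset from [x] makes an arbitrarily small slope with the tangent plane; the
    velocity of a curve in the boundary is thus orthogonal to the normal. *)
Lemma boundary_tangent x n (f : 'rV[R]_d -> 'rV[R]_d) z v :
  outward_normal Omega x n -> f z = x -> differentiable f z ->
  (forall t : R, 0 <= t <= 1 -> boundary Omega (f (z + t *: v))) ->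
  dot ('D_v f z) n = 0.
Proof.
move=> [_ nn] fz df fb; set u := 'D_v f z.
have key (e : R) : 0 < e -> `|dot u n| <= e * `|u|.
  move=> e0; apply: (@derive_right_limit _ _ _ f z v [set y | `|dot y n| <= e * `|y|]).
  - rewrite (_ : mkset _ = [set y : 'rV[R]_d | `|dot y n| - e * `|y| <= 0]); last first.
      by apply/seteqP; split => y /=; rewrite subr_le0.
    apply: closed_sublevel; apply: cts_sub.
      apply: cts_norm => y; apply: (@cts_at_sum _ R^o) => j.
      apply: (@continuousM _ 'rV[R]_d (fun y => y 0 j) (cst (n 0 j))); last exact: cst_continuous.
      exact: coord_continuous.
    by apply: cts_mul; [exact: cst_continuous|exact: norm_continuous].
  - exact: diff_derivable.
  have fc : f (z + t *: v) @[t --> (0 : R)] --> x.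
    rewrite -fz -[X in _ --> f X]addr0 -[X in _ --> f (_ + X)](scale0r v).
    apply: (@continuous_comp _ _ _ (fun t : R => z + t *: v) f).
      by apply: cvgD; [exact: cvg_cst|apply: cvgZ; [exact: cvg_id|exact: cvg_cst]].
    by rewrite scale0r addr0; exact: differentiable_continuous.
  have near1 := fc _ (nn e e0).
  have near2 : \forall t \near (0 : R), t < 1.
    by exists 1 => //= t; rewrite /= sub0r normrN => /ltr_normlW.
  have : \forall t \near (0 : R), t < 1 /\
     ((dot (f (z + t *: v) - x) n < - (e * `|f (z + t *: v) - x|) -> Omega (f (z + t *: v))) /\
     (e * `|f (z + t *: v) - x| < dot (f (z + t *: v) - x) n -> ~ closure Omega (f (z + t *: v)))).
    exact: filterI.
  apply: filterS => t [t1 [h1 h2]] t0 /=.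
  have /boundaryP[b1 b2] : boundary Omega (f (z + t *: v)) by apply: fb; rewrite !ltW.
  rewrite dotZl !normrM normrZ mulrCA ler_wpM2l// fz ler_norml.
  rewrite leNgt (introN idP (fun h => b2 (h1 h)))/= leNgt.
  by apply/negP => /h2.
apply/eqP; rewrite -normr_le0; apply/ler_addgt0Pr => e e0; rewrite add0r.
have u1 : 0 < `|u| + 1 by rewrite ltr_wpDl.
apply: le_trans (key (e / (`|u| + 1)) (divr_gt0 e0 u1)) _.
by rewrite mulrAC ler_pdivrMr// ler_pM2l// lerDl.
Qed.

Lemma dot_linear (n u v : 'rV[R]_d) (s : R) : dot (s *: u + v) n = s * dot u n + dot v n.
Proof. by rewrite -[v in LHS]scale1r dot_lin mul1r. Qed.

(** The function vanishes on the boundary facet, and the facet lies in the boundary: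
    both the gradient and the normal annihilate the tangent directions of the facet,
    so [facet_functional] writes them as multiples of one and the same linear form and
    their cross product is zero. *)
Lemma tangential_trace0_grad : tangential_trace0 M (grad w).
Proof.
move=> K a Ka x n [z za zx] xn.
have [[_ /(_ K)[p pp wp]] w0] := hw; have [dp Dp] := poly_fun_diff pp.
have [W [g [oW KW gW gK geoW]]] := element_chart hmesh K.
have Kz : Khat z by case: za.
have Wx : W x by apply: KW; exists z.
have [dgeo gz] := gK z Kz; rewrite zx in gz.
have qC1 := poly_comp_C1 oW gW pp; pose q := p \o g.
have seg b t : b != a -> 0 <= t <= 1 -> Kfacet a (z + t *: (Kvertex b - z)).
  by move=> ba t01; exact: Kfacet_segment.
have p0 y : Kfacet a y -> p y = 0.
  move=> ya; rewrite -wp; last by case: ya.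
  by apply: w0; apply: Ka; exists y.
have Dp0 b : b != a -> 'D_(Kvertex b - z) p z = 0.
  move=> ba; apply: (@derive_right_limit _ _ R^o p z _ [set 0]).
  - exact: closed_eq.
  - exact: diff_derivable.
  have : \forall t \near (0 : R), t < 1.
    by exists 1 => //= t; rewrite /= sub0r normrN => /ltr_normlW.
  apply: filterS => t t1 t0 /=.
  by rewrite !p0 ?subrr ?scaler0//; apply: seg => //; rewrite !ltW.
have Dn0 b : b != a -> dot ('D_(Kvertex b - z) (geo K) z) n = 0.
  move=> ba; apply: (boundary_tangent xn zx dgeo) => t t01.
  by apply: Ka; exists (z + t *: (Kvertex b - z)) => //; exact: seg.
pose l v := bary ('D_v g x) a - bary 0 a.
have qE v : 'D_v q x = l v * 'D_(Kvertex a - z) p z.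
  rewrite /q derive_comp//; last exact: (gW x Wx).1.
  rewrite gz; apply: (@facet_functional _ _ (fun u => 'D_u p z)) => // s u u'.
  by rewrite !deriveE// linearP.
have nE v : dot n v = l v * dot ('D_(Kvertex a - z) (geo K) z) n.
  have vE : v = 'D_('D_v g x) (geo K) z.
    have dg := (gW x Wx).1.
    rewrite -[z in RHS]gz -derive_comp// ?gz//.
    rewrite -[LHS](derive_id x v); apply: near_eq_derive.
    have : \forall y \near x, W y by apply: open_nbhs_nbhs.
    by apply: filterS => y Wy; rewrite /= geoW.
  rewrite dotC {1}vE; apply: (@facet_functional _ _ (fun u => dot ('D_u (geo K) z) n)) => // s u u'.
  by rewrite !deriveE// linearP dot_linear.
have crossE : cross (grad q x) (embed n) = 0.
  have gq k : grad q x 0 k = l (axis k) * 'D_(Kvertex a - z) p z by rewrite mxE qE.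
  have en k : embed n 0 k = l (axis k) * dot ('D_(Kvertex a - z) (geo K) z) n.
    by rewrite mxE nE.
  apply/rowP => k; rewrite [LHS]mxE [RHS]mxE (gq (k + 1)) (gq (k + 2%:R)).
  rewrite (en (k + 1)) (en (k + 2%:R)).
  by move: (l _) (l _) ('D__ p _) (dot _ n) => s t u u'; ring.
have cgrad k : 'D_(axis k) q y @[y --> x] --> 'D_(axis k) q x by exact: (qC1 x Wx).2.
have FF : Filter (nbhs x) := nbhs_filter (x : 'rV[R]_d).
have cq : cross (grad q y) (embed n) @[y --> x] --> (0 : 'rV[R]_3).
  rewrite -crossE; under eq_fun do rewrite cross_delta; rewrite cross_delta.
  apply: (@cts_at_sum _ 'rV[R]_3 'rV[R]_d _ x) => k.
  apply: (@continuousZ _ 'rV[R]_3 'rV[R]_d (fun y => grad q y 0 k)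
    (cst (cross (delta_mx 0 k) (embed n)))); last exact: cst_continuous.
  rewrite (_ : (fun y => _) = 'D_(axis k) q); first exact: cgrad.
  by apply/funext => y; rewrite mxE.
have cqw : cross (grad q y) (embed n) @[y --> within (element K)° (nbhs x)] --> (0 : 'rV[R]_3).
  by move=> B cqB; apply: (@filterS _ (nbhs x) _ _ _ _ (cq B cqB)) => y By _.
apply: cvg_trans cqw; apply: near_eq_cvg.
have qw y : (element K)° y -> cross (grad q y) (embed n) = cross (grad w y) (embed n).
  move=> iy; congr cross; apply/rowP => k; rewrite !mxE; apply: near_eq_derive.
  have : \forall y' \near y, element K y' by [].
  by apply: filterS => _ [z' Kz' <-]; rewrite /q /= (gK z' Kz').2 -wp.
exact: (@filterE _ (nbhs x) FF _ qw).
Qed.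

Lemma grad_in_Hh0 : (d <= 3)%N -> in_Hh0 M (grad w).
Proof.
move=> d3; split; last exact: tangential_trace0_grad; split.
- exists (fun=> 0); rewrite (_ : (fun x => _) = grad w); first exact: weak_curl_grad.
  by apply/funext => x; exact: embed_planar_grad.
- by move=> K j; exact: pull_back_grad.
- move=> k dk; rewrite (_ : component _ k = fun=> 0); first exact: in_Vh0.
  by apply/funext => x; exact: grad_out.
Qed.

End scalar_potential.

(** * The complete update *)

Theorem proposition3p2 (R : realType) (d : nat) (hd : d = 2%N \/ d = 3%N)
    (M : fe_mesh R d) (hOmega : bounded_domain (Omega M))
    (hmesh : conforming_simplicial_mesh M) (hbasis : nodal_basis M)
    (mu di r : R) (hmu : 0 < mu) (hdi : 0 < di) (hr : 0 < r)
    (rh : 'rV[R]_d -> R) (hrh : in_Vh M rh)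
    (hrh_ge : forall x, Omega M x -> r <= rh x)
    (s : R * R -> R) (D : set (R * R)) (hs : equation_of_state s D)
    (P : euler_procedure R (vertex M))
    (un u1 u2 un1 : hydro R (vertex M)) (tau : R)
    (Hn Hn1 : 'rV[R]_d -> 'rV[R]_3)
    (hmn : forall x n, boundary (Omega M) x -> outward_normal (Omega M) x n ->
       dot (fe_vec (mom un) x) (embed n) = 0)
    (hHn : in_Hh0 M Hn)
    (hupd : hall_mhd_update mu di rh P un Hn tau u1 u2 un1 Hn1) :
  [/\ conservative (@lumped_mass R d M) P ->
        \sum_i lumped_mass i * ene un1 i
          + mu / 2 * normL2 (Omega M) Hn1 ^+ 2
        = \sum_i lumped_mass i * ene un i
          + mu / 2 * normL2 (Omega M) Hn ^+ 2,
      preserves_admissible P -> admissible un -> admissible un1,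
      entropy_dissipative s D (@lumped_mass R d M) P ->
        (forall i, [/\ D (thermo un i), D (thermo u1 i),
                       D (thermo u2 i) & D (thermo un1 i)]) ->
        \sum_i lumped_mass i * math_entropy s un1 i
          <= \sum_i lumped_mass i * math_entropy s un i &
      forall w, in_Ph0 M w ->
        ipL2 (Omega M) Hn1 (grad w) = ipL2 (Omega M) Hn (grad w)].
Proof.
case: hupd => step1 rho0 src step2.
have tau0 : 0 < tau := euler_dt_gt0 step1.
have tau20 : 0 <= 2 * tau by rewrite mulr_ge0// ltW.
have e1 : euler_step P un u1 by left; exists tau.
have e2 : euler_step P u2 un1 by right; exists tau.
have hHn1 : in_Hh0 M Hn1 by case: src => v2 [cH] /= [[]].
have mO := Omega_measurable hOmega.
have normE H : normL2 (Omega M) H ^+ 2 = ipL2 (Omega M) H H.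
  by rewrite sqr_sqrtr//; apply: Rintegral_ge0 => x _; exact: dot_ge0.
split.
- move=> consP; have [_ _ c1] := consP _ _ e1; have [_ _ c2] := consP _ _ e2.
  rewrite !normE c2 -c1.
  exact: (source_update_energy hOmega hmesh hbasis hrh rho0 hHn src).
- move=> admP adm0; apply: (admP _ _ e2); have adm1 := admP _ _ e1 adm0.
  exact: (source_update_admissible hmesh hbasis hr hrh_ge src tau20 adm1).
- move=> entP domD.
  have Dn i : D (thermo un i) by case: (domD i).
  have D1 i : D (thermo u1 i) by case: (domD i).
  have D2 i : D (thermo u2 i) by case: (domD i).
  have D3 i : D (thermo un1 i) by case: (domD i).
  apply: le_trans (entP _ _ e2 D2 D3) _; apply: le_trans (entP _ _ e1 Dn D1).
  exact: (source_update_entropy hmesh hbasis hr hrh_ge rho0 src hs tau20 D1 D2).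
- move=> w hw; have d3 : (d <= 3)%N by case: hd => ->.
  case: src => v2 [cH] /= [_ _ _ weakH _].
  have := weakH _ _ (grad_in_Hh0 hOmega hmesh hw d3) (weak_curl_grad hOmega hmesh hw).
  have gL2 := grad_L2 hOmega hmesh hw.
  have Ln := in_Hh_L2 hOmega hmesh hHn.1; have Ln1 := in_Hh_L2 hOmega hmesh hHn1.1.
  have z1 F G : ipL2 (Omega M) (fun x => cross 0 (F x)) G = 0.
    rewrite /ipL2 (_ : (fun x => _) = cst 0) ?Rintegral_cst ?mul0r//.
    apply/funext => x; rewrite (_ : cross 0 _ = 0) ?dot0l//.
    by apply/rowP => k; rewrite !mxE !mul0r subrr.
  have z2 F : ipL2 (Omega M) F (fun=> 0) = 0.
    rewrite ipL2C /ipL2 (_ : (fun x => _) = cst 0) ?Rintegral_cst ?mul0r//.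
    by apply/funext => x; rewrite dot0l.
  rewrite z1 !z2 !mulr0 !addr0 => /eqP; rewrite mulf_eq0 (gt_eqF hmu)/= => /eqP.
  have -> : (fun x => Hn1 x - Hn x) = (fun x => 1 *: Hn1 x + (- 1) *: Hn x).
    by apply/funext => x; rewrite scale1r scaleN1r.
  by rewrite ipL2_lin// mul1r mulN1r => /eqP; rewrite subr_eq0 => /eqP.
Qed.
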